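(* Let $(X,d,\mu)$ be a uniformly perfect metric-measure space and fix parameters $\sigma\in(1,\infty)$ and $s\in(0,\infty)$. Then the following statements are equivalent. (a) There exists a finite constant $\kappa>0$ such that $$\mu(B(x,r))\ge \kappa\, r^s\quad\text{for every }x\in X\text{ and every finite }r\in(0,\operatorname{diam}(X)].$$ (b) There exist $p\in(0,s)$ and $C\in(0,\infty)$ such that for every ball $B_0:=B(x_0,R_0)$ with $x_0\in X$ and finite $R_0\in(0,\operatorname{diam}(X)]$ one has $$\left(\frac1{\mu(B_0)}\int_{B_0}|u|^{p^*}d\mu\right)^{1/p^*}\le C\left(\frac{\mu(\sigma B_0)}{R_0^s}\right)^{1/p}\left[R_0\left(\frac1{\mu(\sigma B_0)}\int_{\sigma B_0}g^p\,d\mu\right)^{1/p}+\left(\frac1{\mu(\sigma B_0)}\int_{\sigma B_0}|u|^p\,d\mu\right)^{1/p}\right]$$ whenever $u\in M^{1,p}(\sigma B_0,d,\mu)$ and $g\in D(u)$. Here $p^*=sp/(s-p)$. (c) There exist $p\in(0,s)$ and $C\in(0,\infty)$ such that, with $p^*=sp/(s-p)$, for every ball $B_0:=B(x_0,R_0)$ with $x_0\in X$ and finite $R_0\in(0,\operatorname{diam}(X)]$ one has $$\inf_{\gamma\in\mathbb R}\left(\frac1{\mu(B_0)}\int_{B_0}|u-\gamma|^{p^*}d\mu\right)^{1/p^*}\le C\left(\frac{\mu(\sigma B_0)}{R_0^s}\right)^{1/p}R_0\left(\frac1{\mu(\sigma B_0)}\int_{\sigma B_0}g^p\,d\mu\right)^{1/p}$$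 whenever $u\in M^{1,p}(\sigma B_0,d,\mu)$ and $g\in D(u)$. (d) There exist constants $C_1,C_2,\gamma\in(0,\infty)$ such that $$\frac1{\mu(B_0)}\int_{B_0}\exp\left[\left(C_1\frac{|u-u_{B_0}|}{\|g\|_{L^s(\sigma B_0,\mu)}}\right)^{\gamma}\right]d\mu\le C_2$$ whenever $B_0\subseteq X$ is a ball with finite radius at most $\operatorname{diam}(X)$, $u\in M^{1,s}(\sigma B_0,d,\mu)$ and $g\in D_+(u)$. (e) There exist $p\in(s,\infty)$ and a constant $C\in(0,\infty)$ such that for every $u\in M^{1,p}(X,d,\mu)$ and $g\in D(u)$, after possibly redefining $u$ on a set of $\mu$-measure zero, $$|u(x)-u(y)|\le C\,d(x,y)^{1-s/p}\|g\|_{L^p(X,\mu)}\quad\text{for all }x,y\in X.$$ (Hence, every function $u\in M^{1,p}(X,d,\mu)$ has a Hölder continuous representative of order $1-s/p$ on $X$.)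
   Context: A metric-measure space $(X,d,\mu)$ is a metric space $(X,d)$ with a Borel measure $\mu$ such that $0<\mu(B(x,r))<\infty$ for all $x\in X$, $r\in(0,\infty)$, where $B(x,r)=\{y\in X: d(x,y)<r\}$. Metric spaces are always assumed to have at least two points. Balls come with a specified center and a specified (here positive, finite) radius; for $B=B(x,r)$ and $\tau>0$, $\tau B:=B(x,\tau r)$. $(X,d)$ is uniformly perfect if there is $\lambda\in(0,1)$ such that for each $x\in X$ and $r\in(0,\infty)$, $B(x,r)\setminus B(x,\lambda r)\neq\emptyset$ whenever $X\setminus B(x,r)\neq\emptyset$. ''Every finite $r\in(0,\operatorname{diam}(X)]$'' means every $r\in(0,\operatorname{diam}(X)]$ if $\operatorname{diam}(X)<\infty$ and every $r\in(0,\infty)$ if $\operatorname{diam}(X)=\infty$. For a nonempty open set $\Omega\subseteq X$ (including $\Omega=X$) and $0<p<\infty$, $M^{1,p}(\Omega,d,\mu)$ is the set of $u\in L^p(\Omega,\mu)$ (real-valued, functions equal $\mu$-a.e. being identified) for which there are $0\le g\in L^p(\Omega,\mu)$ and a set $N\subseteq\Omega$ with $\mu(N)=0$ such that $|u(x)-u(y)|\le d(x,y)(g(x)+g(y))$ for all $x,y\in\Omega\setminus N$. $D(u)$ denotes the class of all such functions $g$, and $D_+(u)=\{g\in D(u):\|g\|_{L^p(\Omega,\mu)}>0\}$. $u_{B_0}=\frac1{\mu(B_0)}\int_{B_0}u\,d\mu$; in (d) it is understood as part of the statement that $u$ is integrable on $B_0$, so that $u_{B_0}$ is defined. *)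

(* Defs.v *)
From HB Require Import structures.
From mathcomp Require Import all_boot all_order all_algebra.
From mathcomp Require Import all_classical all_reals all_analysis.

Set Implicit Arguments.
Unset Strict Implicit.
Unset Printing Implicit Defensive.

Import Order.TTheory GRing.Theory Num.Theory.

Local Open Scope classical_set_scope.
Local Open Scope ring_scope.

HB.mixin Record isBorelMetric (d : measure_display) (R : realType) T
    & Metric R T & Measurable d T := {
  measurable_borelE : @measurable d T = <<s @open T >>
}.

#[short(type="borelMetricType")]
HB.structure Definition BorelMetric (d : measure_display) (R : realType) :=
  {T of Metric R T & Measurable d T & isBorelMetric d R T}.

Section metric.
Context (d : measure_display) (R : realType) (X : borelMetricType d R).

(* For a real r, r%:E <= diam X reads "r <= diam X" when the diameter is finite
   and is no restriction when it is infinite. *)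
Definition diam : \bar R :=
  ereal_sup [set (mdist xy.1 xy.2)%:E | xy in [set: X * X]].

Definition uniformly_perfect : Prop :=
  exists lambda : R, [/\ 0 < lambda, lambda < 1 &
    forall (x : X) (r : R), 0 < r ->
      ~` ball x r !=set0 -> ball x r `\` ball x (lambda * r) !=set0].

End metric.
Arguments diam {d R} X.
Arguments uniformly_perfect {d R} X.

Section metric_measure.
Context (d : measure_display) (R : realType) (X : borelMetricType d R).
Variable mu : {measure set X -> \bar R}.
Implicit Types (Omega B : set X) (u g : X -> R) (p : R).

Definition metric_measure_space : Prop :=
  (exists x y : X, x <> y) /\
  forall (x : X) (r : R), 0 < r -> (0 < mu (ball x r) < +oo)%E.

(* A function on Omega is represented by a total function on X of which only
   the values on Omega are used. *)
Definition Lp_norm Omega p u : \bar R := 'N[mu]_p%:E[(EFin \o u) \_ Omega].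

Lemma Lp_normE Omega p u : p != 0 ->
  Lp_norm Omega p u = ((\int[mu]_(x in Omega) (`|u x| `^ p)%:E) `^ p^-1)%E.
Proof.
move=> p0; rewrite /Lp_norm unlock; congr (poweR _ _).
rewrite [RHS]integral_mkcond; apply: eq_integral => x _.
by rewrite !patchE; case: ifPn => //= _; rewrite normr0 powR0.
Qed.

Definition Lp Omega p : set (X -> R) :=
  [set u | measurable_fun Omega u /\ (Lp_norm Omega p u < +oo)%E].

(* The class D(u) on Omega. *)
Definition hajlasz_gradients Omega p u : set (X -> R) :=
  [set g | [/\ forall x, Omega x -> 0 <= g x, Lp Omega p g &
    exists N : set X, [/\ N `<=` Omega, measurable N, mu N = 0 &
      forall x y, (Omega `\` N) x -> (Omega `\` N) y ->
        `|u x - u y| <= mdist x y * (g x + g y)]]].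

(* The class D_+(u) on Omega. *)
Definition hajlasz_gradients_pos Omega p u : set (X -> R) :=
  [set g | hajlasz_gradients Omega p u g /\ (0 < Lp_norm Omega p g)%E].

(* M^{1,p}(Omega), as a set of representatives. *)
Definition hajlasz_sobolev Omega p : set (X -> R) :=
  [set u | Lp Omega p u /\ hajlasz_gradients Omega p u !=set0].

(* Meaningful for 0 < mu B < +oo. *)
Definition average B (f : X -> \bar R) : \bar R :=
  ((fine (mu B))^-1%:E * \int[mu]_(x in B) f x)%E.

(* (average of |u|^q over B)^{1/q} *)
Definition average_norm B (q : R) u : \bar R :=
  (average B (fun x => (`|u x| `^ q)%:E) `^ q^-1)%E.

End metric_measure.

Definition sobolev_conjugate (R : realType) (s p : R) : R := s * p / (s - p).

(* Main.v *)
Require Import Defs.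
From mathcomp Require Import all_boot all_order all_algebra.
From mathcomp Require Import all_classical all_reals all_analysis.
From mathcomp Require Import measurable_realfun ring lra.

Set Implicit Arguments.
Unset Strict Implicit.
Unset Printing Implicit Defensive.

Import Order.TTheory GRing.Theory Num.Theory.
Import numFieldNormedType.Exports.

Local Open Scope classical_set_scope.
Local Open Scope ring_scope.

(* From (a) to the embeddings: if the L^p norm of g is less than kappa^(1/p) K,
   then by (a) every admissible ball of radius r contains a point z, outside any
   null set, with g z <= K r^(-s/p). Following such points in the balls
   B(x, r0 / 4^i) towards x and summing the increments of u bounds
   |u x - u z0| by K r0^(-1) + (K g x)^(1/2) for p = s/2, by K times a multiple of
   1 + log (1 + r0 g x / K) for p = s, and by K r0^(1/2) for p = 2s; these
   exponents are the ones used for (b) and (c), for (d), and for (e). Integrating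
   gives (b), (c), (d), and McShane's extension gives (e).

   Back to (a): test the embeddings on Lipschitz cutoffs between concentric balls
   of radii rho/2 < r_(j+1) < r_j <= rho inside B(x, r). Uniform perfectness
   provides two disjoint balls of radius rho comparable to r in B(x, r); centering
   the cutoffs at the one of smaller measure, the cutoff differs by at least 1/2
   from any given constant on a set at least as large as the inner ball. Hence the
   ratios m_j of the measures of B(w, r_j) and B(x, r) satisfy
   m_(j+1) <= D 2^(qj) (e m_j)^tau with tau > 1 and e the ratio of the measure of
   B(x, r) to r^s. As the m_j are bounded away from 0, e cannot be small. For (e)
   a single cutoff suffices. *)

(** * Real powers and a superlinear recursion *)

Section real_powers.
Context {R : realType}.
Implicit Types (x y p q r : R).

Lemma le_powR r x y : 0 <= r -> 0 <= x -> x <= y -> x `^ r <= y `^ r.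
Proof.
move=> r0 x0 xy; apply: ge0_ler_powR; rewrite ?nnegrE//; exact: le_trans xy.
Qed.

Lemma powRK r x : r != 0 -> 0 <= x -> (x `^ r) `^ r^-1 = x.
Proof. by move=> r0 x0; rewrite -powRrM mulfV// powRr1. Qed.

Lemma powRVK r x : r != 0 -> 0 <= x -> (x `^ r^-1) `^ r = x.
Proof. by move=> r0 x0; rewrite -powRrM mulVf// powRr1. Qed.

Lemma powRV r x : 0 <= x -> x^-1 `^ r = (x `^ r)^-1.
Proof. by move=> x0; rewrite -powR_inv1// powRAC powR_inv1// powR_ge0. Qed.

Lemma powR_div r x y : 0 <= x -> 0 <= y -> (x / y) `^ r = x `^ r / y `^ r.
Proof. by move=> x0 y0; rewrite powRM ?invr_ge0// powRV. Qed.

Lemma powRX r x n : 0 <= x -> (x ^+ n) `^ r = (x `^ r) ^+ n.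
Proof. by move=> x0; rewrite -!powR_mulrn ?powR_ge0// powRAC. Qed.

(** The sum is at most twice the larger term; this covers exponents below and above 1 alike, as is
    needed for s and s/2. *)
Lemma powRD_le r x y : 0 <= r -> 0 <= x -> 0 <= y ->
  (x + y) `^ r <= 2 `^ r * (x `^ r + y `^ r).
Proof.
move=> r0 x0 y0; wlog xy : x y x0 y0 / x <= y.
  by move=> h; case: (leP x y) => [|/ltW] xy; [|rewrite addrC (addrC (x `^ r))]; exact: h.
apply: (@le_trans _ _ ((2 * y) `^ r)); first by apply: le_powR; lra.
by rewrite powRM// ler_wpM2l ?powR_ge0// lerDr powR_ge0.
Qed.

Lemma powR_le_cancel p x y : 0 < p -> 0 <= x -> 0 <= y -> x `^ p <= y `^ p -> x <= y.
Proof.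
move=> p0 x0 y0 /(le_powR _ (powR_ge0 _ _)).
move=> /(_ p^-1); rewrite invr_ge0 => /(_ (ltW p0)).
by rewrite !powRK ?gt_eqF.
Qed.

Lemma exists_expr_lt (Q e : R) : 0 <= Q -> Q < 1 -> 0 < e -> exists n, Q ^+ n < e.
Proof.
move=> Q0 Q1 e0; have : (Q ^+ n @[n --> \oo] --> (0:R))%classic.
  by apply: cvg_expr; rewrite ger0_norm.
move=> /cvgrPdist_lt /(_ e e0) [N _ h]; exists N.
by have := h N (leqnn N); rewrite /= sub0r normrN ger0_norm// exprn_ge0.
Qed.

(* De Giorgi's iteration: for small [e] the recursion forces [m] to decay
   geometrically. *)
Lemma superlinear_recursion (D tau q : R) : 0 < D -> 1 < tau -> 0 < q ->
  exists eta, 0 < eta /\ forall (e delta : R) (m : nat -> R),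
    0 < e -> 0 < delta -> (forall j, delta <= m j) -> m 0%N <= 1 ->
    (forall j, m j.+1 <= D * (2 ^+ j) `^ q * (e * m j) `^ tau) -> eta <= e.
Proof.
(* [Q] solves 2^q Q^tau = Q, so the bound m_j <= Q^j reproduces itself under the recursion as soon
   as D e^tau <= Q. *)
move=> D0 tau1 q0; pose Q : R := 2 `^ (- (q / (tau - 1))).
have t1 : 0 < tau - 1 by lra.
have Q0 : 0 < Q by rewrite powR_gt0.
have Q1 : Q < 1.
  rewrite /Q powRN invf_lt1 ?powR_gt0//.
  rewrite /powR pnatr_eq0 /= -[ltLHS]expR0 ltr_expR mulr_gt0 ?divr_gt0//.
  by rewrite ln_gt0// ltr1n.
have hQ : 2 `^ q * Q `^ tau = Q.
  rewrite /Q -powRrM -powRD; last by apply/implyP; rewrite pnatr_eq0.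
  by congr (_ `^ _); field; rewrite gt_eqF.
have tau0 : 0 < tau by lra.
(* The threshold is the value of [e] at which D e^tau = Q. *)
exists ((Q / D) `^ tau^-1); split; first by rewrite powR_gt0 ?divr_gt0.
move=> e delta m e0 d0 dm m0 hm; rewrite leNgt; apply/negP => small.
have De : D * e `^ tau <= Q.
  rewrite mulrC -ler_pdivlMr//.
  have -> : Q / D = ((Q / D) `^ tau^-1) `^ tau.
    by rewrite powRVK ?gt_eqF// ltW ?divr_gt0.
  by apply: le_powR; rewrite ?ltW.
have mQ j : m j <= Q ^+ j.
  elim: j => [|j IH]; first by rewrite expr0.
  have mj0 : 0 <= m j by apply: le_trans (dm j); exact: ltW.
  apply: le_trans (hm j) _; rewrite powRM ?(ltW e0)//.
  have -> : D * (2 ^+ j) `^ q * (e `^ tau * m j `^ tau) =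
    (D * e `^ tau) * ((2 `^ q) ^+ j * m j `^ tau) by rewrite powRX//; ring.
  apply: (@le_trans _ _ (Q * ((2 `^ q) ^+ j * (Q `^ tau) ^+ j))).
    apply: ler_pM => //.
    - by rewrite mulr_ge0 ?powR_ge0 ?ltW.
    - by rewrite mulr_ge0 ?exprn_ge0 ?powR_ge0.
    rewrite -[(Q `^ tau) ^+ j]powRX ?(ltW Q0)// ler_wpM2l ?exprn_ge0 ?powR_ge0//.
    by apply: le_powR => //; exact: ltW.
  by rewrite -exprMn hQ exprS.
have [n hn] := exists_expr_lt (ltW Q0) Q1 d0.
by have := le_lt_trans (le_trans (dm n) (mQ n)) hn; rewrite ltxx.
Qed.

End real_powers.

(** * Balls, annuli and Lipschitz cutoffs in a metric space *)

Section metric_geometry.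
Context {R : realType} {d : measure_display} {X : borelMetricType d R}.
Implicit Types (x y z : X) (r : R).

Lemma open_metric_ball x r : open (ball x r).
Proof.
rewrite openE => y; rewrite ballEmdist /= => xyr.
rewrite /interior; apply/nbhs_ballP; exists (r - mdist x y) => /=; first lra.
move=> z; rewrite !ballEmdist /= => yz.
by have := metric_triangle x y z; lra.
Qed.

Lemma measurable_metric_ball x r : measurable (ball x r).
Proof.
rewrite measurable_borelE; apply: sub_sigma_algebra; exact: open_metric_ball.
Qed.

Lemma measurable_mdist x : measurable_fun [set: X] (mdist x).
Proof.
move=> mT; apply: (measurability _ (RGenInftyO.measurableE R)) => //.
move=> /= _ [_ [a ->] <-]; rewrite setTI.
rewrite (_ : _ @^-1` _ = ball x a); first exact: measurable_metric_ball.
by rewrite ballEmdist; apply/seteqP; split=> y /=; rewrite in_itv.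
Qed.

Lemma mdist_le_diam x y : ((mdist x y)%:E <= diam X)%E.
Proof. by apply: ereal_sup_ubound; exists (x, y). Qed.

(** If the ball of radius r/3 were the whole space, the diameter would be at most 2r/3, by the
    triangle inequality through [x]. *)
Lemma exists_far_point x r : 0 < r -> (r%:E <= diam X)%E ->
  ~` ball x (r / 3) !=set0.
Proof.
move=> r0 rd; apply: contrapT => /set0P/negP/negPn/eqP h.
have near y : mdist x y < r / 3.
  apply: contrapT => hy; suff : set0 y by [].
  by rewrite -h /= ballEmdist.
have : (diam X <= (2 * (r / 3))%:E)%E.
  apply: ge_ereal_sup => _ [[y z] _ <-] /=; rewrite lee_fin.
  have := metric_triangle y x z; have := near y; have := near z.
  by rewrite (metric_sym y x); lra.
by move=> /(le_trans rd); rewrite lee_fin; lra.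
Qed.

(** Uniform perfectness at radius r/3 gives a second center at distance comparable to [r], which
    leaves room for two disjoint balls inside [ball x r]. *)
Lemma annulus_point (lambda : R) : 0 < lambda -> lambda < 1 ->
  (forall x r, 0 < r -> ~` ball x r !=set0 ->
     ball x r `\` ball x (lambda * r) !=set0) ->
  forall x r, 0 < r -> (r%:E <= diam X)%E ->
  exists y, lambda * (r / 3) <= mdist x y < r / 3.
Proof.
move=> l0 l1 up x r r0 rd.
have [|y []] := up x (r / 3) _ (exists_far_point x r0 rd); first lra.
rewrite !ballEmdist /= => yr /negP; rewrite -leNgt => ly.
by exists y; rewrite ly.
Qed.

Definition cutoff w (r' r : R) : X -> R :=
  fun y => Num.max 0 (Num.min 1 ((r - mdist w y) / (r - r'))).

Lemma cutoff_ge0 w r' r y : 0 <= cutoff w r' r y.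
Proof. by rewrite /cutoff le_max lexx. Qed.

Lemma cutoff_le1 w r' r y : cutoff w r' r y <= 1.
Proof. by rewrite /cutoff ge_max ler01 ge_min lexx. Qed.

Lemma cutoff_eq1 w r' r y : r' < r -> ball w r' y -> cutoff w r' r y = 1.
Proof.
move=> rr; rewrite ballEmdist /= => wy; rewrite /cutoff.
rewrite min_l ?max_r// ler_pdivlMr; lra.
Qed.

Lemma cutoff_eq0 w r' r y : r' < r -> ~ ball w r y -> cutoff w r' r y = 0.
Proof.
move=> rr; rewrite ballEmdist /= => /negP; rewrite -leNgt => wy; rewrite /cutoff.
by rewrite max_l// ge_min; apply/orP; right; rewrite ler_pdivrMr; lra.
Qed.

Lemma measurable_cutoff w r' r D : measurable_fun D (cutoff w r' r).
Proof.
apply: (@measurable_funS _ _ _ _ setT) => //.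
apply: measurable_maxr; first exact: measurable_cst.
apply: measurable_minr; first exact: measurable_cst.
apply: measurable_funM; last exact: measurable_cst.
apply: measurable_funB; first exact: measurable_cst.
exact: measurable_mdist.
Qed.

Lemma cutoff_lipschitz w r' r x y : r' < r ->
  `|cutoff w r' r x - cutoff w r' r y| <= mdist x y * (r - r')^-1.
Proof.
move=> rr; have L0 : 0 < (r - r')^-1 by rewrite invr_gt0; lra.
rewrite /cutoff.
set a := (r - mdist w x) / _; set b := (r - mdist w y) / _.
(* Clamping to the interval [0, 1] does not increase distances, so it suffices to treat the
   unclamped profile. *)
suff h : `|a - b| <= mdist x y * (r - r')^-1.
  apply: le_trans h; move: a b => a b.
  rewrite /Num.max /Num.min; repeat case: ifPn; rewrite -?leNgt => *;
    rewrite ler_norml; have := ler_norm (a - b); have := ler_norm (b - a);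
    rewrite (distrC b a) => *; apply/andP; split; lra.
rewrite /a /b -mulrBl normrM (gtr0_norm L0) ler_pM2r//.
have := metric_triangle w x y; have := metric_triangle w y x.
rewrite (metric_sym y x) ler_norml => *; apply/andP; split; lra.
Qed.

(** If one of the points lies in the ball, its own indicator already pays for the Lipschitz bound;
    if neither does, both values of the cutoff vanish. *)
Lemma cutoff_gradient w r' r x y : r' < r ->
  `|cutoff w r' r x - cutoff w r' r y| <=
  mdist x y * ((r - r')^-1 * \1_(ball w r) x + (r - r')^-1 * \1_(ball w r) y).
Proof.
move=> rr; have L0 : 0 < (r - r')^-1 by rewrite invr_gt0; lra.
have [[hx|hy]|h] := pselect (ball w r x \/ ball w r y).
- apply: (le_trans (cutoff_lipschitz _ _ _ rr)); rewrite ler_wpM2l ?mdist_ge0//.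
  rewrite [X in _ * X + _]indicE mem_set// mulr1 lerDl mulr_ge0 ?(ltW L0)//.
- apply: (le_trans (cutoff_lipschitz _ _ _ rr)); rewrite ler_wpM2l ?mdist_ge0//.
  rewrite [X in _ + _ * X]indicE mem_set// mulr1 lerDr mulr_ge0 ?(ltW L0)//.
- have hx : ~ ball w r x by move=> ?; apply: h; left.
  have hy : ~ ball w r y by move=> ?; apply: h; right.
  rewrite !cutoff_eq0// subrr normr0.
  by rewrite mulr_ge0 ?mdist_ge0// addr_ge0// mulr_ge0// ltW.
Qed.

End metric_geometry.

(** * Volumes, averages and Chebyshev-type selection of points *)

Section metric_measure.
Context {R : realType} {d : measure_display} {X : borelMetricType d R}.
Variable mu : {measure set X -> \bar R}.
Implicit Types (x y z : X) (r p q : R) (A B F N Omega : set X) (u g h : X -> R).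

(** [fine] sends an infinite measure to 0, hence the finiteness assumptions in [volE] and
    [vol_le]. *)
Definition vol A : R := fine (mu A).

Lemma vol_ge0 A : 0 <= vol A.
Proof. by rewrite /vol fine_ge0. Qed.

Lemma volE A B : measurable A -> measurable B -> A `<=` B -> (mu B < +oo)%E ->
  mu A = (vol A)%:E.
Proof.
move=> mA mB AB Boo; rewrite /vol fineK// ge0_fin_numE//.
by apply: le_lt_trans Boo; apply: le_measure; rewrite ?inE.
Qed.

Lemma vol_le A B : measurable A -> measurable B -> A `<=` B -> (mu B < +oo)%E ->
  vol A <= vol B.
Proof.
move=> mA mB AB Boo; rewrite -lee_fin -!(@volE _ B)//.
by apply: le_measure; rewrite ?inE.
Qed.

Lemma measurable_powR_norm Omega p u : measurable_fun Omega u ->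
  measurable_fun Omega (fun x => (`|u x| `^ p)%:E).
Proof.
move=> mu0; apply/measurable_EFinP.
apply: (measurableT_comp (measurable_powR p)).
exact: measurableT_comp.
Qed.

(** Replaces the extended-real norm by a real number [A], so that the later estimates take place in
    [R]. *)
Lemma LpP Omega p u : 0 < p -> Lp mu Omega p u ->
  exists A : R, [/\ 0 <= A, Lp_norm mu Omega p u = A%:E &
    (\int[mu]_(x in Omega) (`|u x| `^ p)%:E = (A `^ p)%:E)%E].
Proof.
move=> p0 [mfu]; rewrite Lp_normE ?gt_eqF// => fin.
have I0 : (0 <= \int[mu]_(x in Omega) (`|u x| `^ p)%:E)%E.
  by apply: integral_ge0 => x _; rewrite lee_fin powR_ge0.
have : (\int[mu]_(x in Omega) (`|u x| `^ p)%:E)%E \is a fin_num.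
  by rewrite ge0_fin_numE//; apply: lty_poweRy fin; rewrite invr_eq0 gt_eqF.
move: I0; case: (integral _ _ _) => // I; rewrite lee_fin => I0 _.
exists (I `^ p^-1); split; rewrite ?powR_ge0// ?poweR_EFin//.
by rewrite -powRrM mulVf ?gt_eqF// powRr1.
Qed.

Lemma Lp_intro Omega p u (I : R) : 0 < p -> measurable_fun Omega u ->
  (\int[mu]_(x in Omega) (`|u x| `^ p)%:E <= I%:E)%E -> Lp mu Omega p u.
Proof.
move=> p0 mfu uI; split=> //; rewrite Lp_normE ?gt_eqF//.
by apply: poweR_lty; apply: le_lt_trans uI (ltry _).
Qed.

Lemma average_norm_Lp B p u (A : R) : 0 < p -> 0 <= A ->
  (\int[mu]_(x in B) (`|u x| `^ p)%:E = (A `^ p)%:E)%E ->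
  average_norm mu B p u = ((vol B)^-1 `^ p^-1 * A)%:E.
Proof.
move=> p0 A0 uA; rewrite /average_norm /average uA -EFinM poweR_EFin.
rewrite powRM ?invr_ge0 ?vol_ge0 ?powR_ge0//.
by rewrite -powRrM mulfV ?gt_eqF// powRr1.
Qed.

Lemma average_norm_le B q u (M : R) : 0 < q -> 0 <= M -> 0 < vol B ->
  (\int[mu]_(x in B) (`|u x| `^ q)%:E <= (vol B * M `^ q)%:E)%E ->
  (average_norm mu B q u <= M%:E)%E.
Proof.
move=> q0 M0 V0 uM; rewrite /average_norm /average -/(vol B).
have I0 : (0 <= \int[mu]_(x in B) (`|u x| `^ q)%:E)%E.
  by apply: integral_ge0 => x _; rewrite lee_fin powR_ge0.
move: I0 uM; case: (integral _ _ _) => // I; rewrite !lee_fin => I0 IM.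
have -> : M = (M `^ q) `^ q^-1 by rewrite -powRrM mulfV ?gt_eqF// powRr1.
apply: ge0_ler_powR; rewrite ?nnegrE ?powR_ge0 ?invr_ge0 ?(ltW q0)//.
  by rewrite mulr_ge0// invr_ge0 ltW.
by rewrite mulrC ler_pdivrMr// mulrC.
Qed.

(** Chebyshev's inequality: the integral over the rest of [B] is discarded. *)
Lemma average_ge B F (f : X -> R) (h : R) : 0 <= h -> 0 < vol B ->
  measurable B -> measurable F -> F `<=` B -> (mu B < +oo)%E ->
  measurable_fun B f -> (forall x, B x -> 0 <= f x) -> (forall x, F x -> h <= f x) ->
  ((h * (vol F / vol B))%:E <= average mu B (EFin \o f))%E.
Proof.
move=> h0 V0 mB mF FB Boo mf f0 fh; have mf' : measurable_fun B (EFin \o f).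
  exact/measurable_EFinP.
rewrite mulrA mulrC EFinM; apply: lee_wpmul2l.
  by rewrite lee_fin invr_ge0 vol_ge0.
apply: (@le_trans _ _ (\int[mu]_(x in F) (f x)%:E)%E); last first.
  exact: ge0_subset_integral.
rewrite EFinM -(volE mF mB)// -integral_cst//.
by apply: ge0_le_integral => //; exact: measurable_funS mf'.
Qed.

Lemma average_norm_ge B F q u (h : R) : 0 < q -> 0 <= h -> 0 < vol B ->
  measurable B -> measurable F -> F `<=` B -> (mu B < +oo)%E ->
  measurable_fun B u -> (forall x, F x -> h <= `|u x|) ->
  ((h * (vol F / vol B) `^ q^-1)%:E <= average_norm mu B q u)%E.
Proof.
move=> q0 h0 V0 mB mF FB Boo mfu uh; rewrite /average_norm.
have -> : h * (vol F / vol B) `^ q^-1 = (h `^ q * (vol F / vol B)) `^ q^-1.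
  by rewrite [RHS]powRM ?powR_ge0 ?divr_ge0 ?vol_ge0// powRK ?gt_eqF.
rewrite -poweR_EFin; apply: gt0_ler_poweR; rewrite ?invr_ge0 ?(ltW q0)//.
- by rewrite in_itv /= leey andbT lee_fin !mulr_ge0 ?powR_ge0 ?invr_ge0 ?vol_ge0.
- rewrite in_itv /= leey andbT mule_ge0 ?lee_fin ?invr_ge0 ?vol_ge0//.
  by apply: integral_ge0 => x _; rewrite lee_fin powR_ge0.
apply: average_ge => //; first exact: powR_ge0.
- by apply/measurable_EFinP; exact: measurable_powR_norm.
- by move=> x /uh; apply: le_powR => //; exact: ltW.
Qed.

(** Otherwise [h] exceeds M / vol B on all of [B] off the null set [N], and its integral is at least
    [M]. *)
Lemma exists_small_value Omega B N h (M : R) :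
  measurable Omega -> measurable B -> B `<=` Omega -> mu B = (vol B)%:E ->
  0 < vol B -> measurable N -> mu N = 0%E -> measurable_fun Omega h ->
  (forall x, Omega x -> 0 <= h x) ->
  (\int[mu]_(x in Omega) (h x)%:E < M%:E)%E ->
  exists z, [/\ B z, ~ N z & h z * vol B <= M].
Proof.
move=> mO mB BO muB V0 mN N0 mh h0; apply: contraPP.
move=> /forallNP hn; apply/negP; rewrite -leNgt.
have mBN : measurable (B `\` N) by apply: measurableD.
have mh' : measurable_fun Omega (fun x => (h x)%:E) by exact/measurable_EFinP.
apply: (@le_trans _ _ (\int[mu]_(x in B `\` N) (h x)%:E)%E); last first.
  apply: ge0_subset_integral => //; last by move=> x [/BO].
have -> : M%:E = (\int[mu]_(x in B `\` N) (M / vol B)%:E)%E.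
  rewrite integral_cst//=.
  have -> : mu (B `\` N) = mu B.
    have BN0 : mu (B `&` N) = 0%E.
      by apply: subset_measure0 N0 => //; exact: measurableI.
    have Boo : (mu B < +oo)%E by rewrite muB ltry.
    by rewrite measureD// [X in (_ - X)%E]BN0 sube0.
  by rewrite muB -EFinM divfK// gt_eqF.
(* Monotonicity for nonnegative integrands applies only when [M] is nonnegative; for negative [M]
   the two sides are separated by 0. *)
case: (leP 0 M) => [M0|M0].
  apply: ge0_le_integral => //.
  - by move=> x _; rewrite lee_fin divr_ge0// ltW.
  - by apply: measurable_funS mh' => // x [/BO].
  - move=> x [Bx Nx]; rewrite lee_fin ler_pdivrMr//; have /not_and3P[//|//|/negP] := hn x.
    by rewrite -ltNge => /ltW.
apply: (@le_trans _ _ 0%E).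
  rewrite integral_cst//= mule_le0_ge0// lee_fin.
  by rewrite mulr_le0_ge0 ?invr_ge0 ?ltW.
by apply: integral_ge0 => x [/BO/h0]; rewrite lee_fin.
Qed.

End metric_measure.

(** * Norms of cutoffs, and the volume bound from cutoff estimates *)

Section lower_volume_bounds.
Context {R : realType} {d : measure_display} {X : borelMetricType d R}.
Variable mu : {measure set X -> \bar R}.
Hypothesis mmX : metric_measure_space mu.
Implicit Types (x y z w : X) (r p q : R) (A B F N Omega : set X) (u g h : X -> R).
Local Notation vol := (vol mu).

Lemma mu_ball_lty x r : 0 < r -> (mu (ball x r) < +oo)%E.
Proof. by move=> r0; have /andP[] := mmX.2 x r r0. Qed.

Lemma mu_ballE x r : 0 < r -> mu (ball x r) = (vol (ball x r))%:E.
Proof.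
by move=> r0; apply: volE (mu_ball_lty x r0) => //; exact: measurable_metric_ball.
Qed.

Lemma vol_ball_gt0 x r : 0 < r -> 0 < vol (ball x r).
Proof. by move=> r0; have /andP[] := mmX.2 x r r0; rewrite mu_ballE ?lte_fin. Qed.

Lemma vol_le_ball A x r : measurable A -> 0 < r -> A `<=` ball x r ->
  vol A <= vol (ball x r).
Proof.
move=> mA r0 Ar; apply: vol_le => //; first exact: measurable_metric_ball.
exact: mu_ball_lty.
Qed.

Definition cutoff_slope w r' r : X -> R := fun y => (r - r')^-1 * \1_(ball w r) y.

Section cutoff_norms.
Variables (w : X) (r' r p : R) (Omega : set X).
Hypotheses (r'r : r' < r) (r0 : 0 < r) (p0 : 0 < p).
Hypotheses (mO : measurable Omega) (ballO : ball w r `<=` Omega).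
Let L0 : 0 < (r - r')^-1. Proof. by rewrite invr_gt0 subr_gt0. Qed.

Let integral_indic_ball :
  (\int[mu]_(x in Omega) (\1_(ball w r) x)%:E = (vol (ball w r))%:E)%E.
Proof.
rewrite integral_indic//; last exact: measurable_metric_ball.
by rewrite setIidl// mu_ballE.
Qed.

Lemma integral_cutoff_slope :
  (\int[mu]_(x in Omega) (`|cutoff_slope w r' r x| `^ p)%:E =
   (((r - r')^-1 * vol (ball w r) `^ p^-1) `^ p)%:E)%E.
Proof.
rewrite powRM ?powR_ge0 ?(ltW L0)// powRVK ?gt_eqF ?vol_ge0//.
rewrite EFinM -integral_indic_ball -ge0_integralZl ?lee_fin ?powR_ge0//; last first.
- apply/measurable_EFinP; apply: measurable_indic; exact: measurable_metric_ball.
apply: eq_integral => x _; rewrite -EFinM; congr EFin.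
rewrite /cutoff_slope indicE normrM (gtr0_norm L0).
by case: (_ \in _); rewrite /= ?normr1 ?normr0 ?mulr1 ?mulr0 ?powR0 ?gt_eqF.
Qed.

Lemma integral_cutoff_le :
  (\int[mu]_(x in Omega) (`|cutoff w r' r x| `^ p)%:E <= (vol (ball w r))%:E)%E.
Proof.
rewrite -integral_indic_ball; apply: ge0_le_integral => //.
- by apply: measurable_powR_norm; exact: measurable_cutoff.
- apply/measurable_EFinP; apply: measurable_indic; exact: measurable_metric_ball.
move=> x _; rewrite lee_fin indicE ger0_norm ?cutoff_ge0//.
have [xB|xB] := pselect (ball w r x).
  rewrite mem_set//; have -> : 1 = 1 `^ p :> R by rewrite powR1.
  by apply: le_powR; rewrite ?cutoff_ge0 ?cutoff_le1 ?(ltW p0).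
by rewrite memNset// cutoff_eq0 ?powR0 ?gt_eqF.
Qed.

Lemma measurable_cutoff_slope D : measurable_fun D (cutoff_slope w r' r).
Proof.
apply: measurable_funM; first exact: measurable_cst.
apply: measurable_indic; exact: measurable_metric_ball.
Qed.

Lemma Lp_cutoff_slope : Lp mu Omega p (cutoff_slope w r' r).
Proof.
apply: (Lp_intro p0); first exact: measurable_cutoff_slope.
by rewrite integral_cutoff_slope.
Qed.

Lemma Lp_norm_cutoff_slope : Lp_norm mu Omega p (cutoff_slope w r' r) =
  ((r - r')^-1 * vol (ball w r) `^ p^-1)%:E.
Proof.
rewrite Lp_normE ?gt_eqF// integral_cutoff_slope poweR_EFin powRK ?gt_eqF//.
by rewrite mulr_ge0 ?powR_ge0 ?(ltW L0).
Qed.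

Lemma cutoff_gradients :
  hajlasz_gradients mu Omega p (cutoff w r' r) (cutoff_slope w r' r).
Proof.
split; first by move=> x _; rewrite mulr_ge0// ltW.
  exact: Lp_cutoff_slope.
exists set0; split => // x y _ _; exact: cutoff_gradient.
Qed.

Lemma cutoff_sobolev : hajlasz_sobolev mu Omega p (cutoff w r' r).
Proof.
split; last by exists (cutoff_slope w r' r); exact: cutoff_gradients.
apply: (Lp_intro p0); first exact: measurable_cutoff.
exact: integral_cutoff_le.
Qed.

End cutoff_norms.

(* What the embeddings on balls say about cutoff functions, with [tau > 1]. The
   set [F], on which the cutoff vanishes, prevents the subtracted constant from
   being close to 1. *)
Definition cutoff_estimate (s tau q C : R) : Prop :=
  forall x0 (R0 : R) w r' r F, 0 < R0 -> (R0%:E <= diam X)%E ->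
  0 < r' -> r' < r -> r <= R0 -> ball w r `<=` ball x0 R0 -> measurable F ->
  F `<=` ball x0 R0 `\` ball w r -> vol (ball w r') <= vol F ->
  vol (ball w r') / vol (ball x0 R0) <=
  C * (R0 / (r - r')) `^ q * (vol (ball w r) / R0 `^ s) `^ tau.

Lemma cutoff_estimate_volume (s tau q C : R) : uniformly_perfect X ->
  0 < s -> 1 < tau -> 0 < q -> 0 < C -> cutoff_estimate s tau q C ->
  exists kappa : R, 0 < kappa /\
     forall x (r : R), 0 < r -> (r%:E <= diam X)%E ->
       ((kappa * r `^ s)%:E <= mu (ball x r))%E.
Proof.
move=> [la [la0 la1 up]] s0 tau1 q0 C0 W.
(* The radii [rj] below have gaps rho / 4 / 2^j with rho = la r / 6, so the ratio of [r] to the gap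
   is 24 / la * 2^j. *)
pose D := C * (24 / la) `^ q.
have D0 : 0 < D by rewrite mulr_gt0 ?powR_gt0 ?divr_gt0.
have [eta [eta0 rec]] := superlinear_recursion D0 tau1 q0.
exists eta; split=> // x r r0 rd; rewrite mu_ballE// lee_fin.
have [y /andP[y1 y2]] := annulus_point la0 la1 up x r0 rd.
(* The distance from [x] to [y] is at least 2 rho, so the balls of radius [rho] around them are
   disjoint; as rho < r/6, both lie in [ball x r]. *)
pose rho := la * r / 6.
have rho0 : 0 < rho by rewrite /rho !mulr_gt0.
have lr : la * r < r by rewrite gtr_pMl.
(* The cutoffs are centered at [w], and the ball around [z], of no smaller measure, is the set [F]
   where they vanish. Which of [x] and [y] plays the role of [w] is decided at the end. *)
have key w z : rho + mdist x w <= r -> rho + mdist x z <= r ->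
    2 * rho <= mdist w z -> vol (ball w rho) <= vol (ball z rho) ->
    eta * r `^ s <= vol (ball x r).
  move=> xw xz wz wzv.
  have V0 := vol_ball_gt0 x r0.
  have sub v : rho + mdist x v <= r -> ball v rho `<=` ball x r.
    move=> xv t; rewrite !ballEmdist /= => vt.
    by have := metric_triangle x v t; lra.
  have rs0 : 0 < r `^ s by rewrite powR_gt0.
  pose rj (j : nat) := rho / 2 * (1 + (2 ^+ j)^-1).
  have pj j : 0 < (2 ^+ j)^-1 :> R by rewrite invr_gt0 exprn_gt0.
  have pj1 j : (2 ^+ j)^-1 <= 1 :> R by rewrite invf_le1 ?exprn_gt0// exprn_ege1// ler1n.
  have rj0 j : rho / 2 < rj j by rewrite /rj; have := pj j; nra.
  have rjr j : rj j <= rho.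
    by rewrite /rj; have := pj1 j; nra.
  have rjB j : ball w (rj j) `<=` ball w rho.
    by move=> t; rewrite !ballEmdist /= => /lt_le_trans; apply.
  have mb := @measurable_metric_ball _ _ X.
  rewrite -ler_pdivlMr//.
  (* Here [e] is the ratio of the measure of [ball x r] to r^s; the radii stay above rho/2, which
     supplies the lower bound [delta]. *)
  apply: (rec _ (vol (ball w (rho / 2)) / vol (ball x r))
    (fun j => vol (ball w (rj j)) / vol (ball x r))).
  - by rewrite divr_gt0.
  - by rewrite divr_gt0// vol_ball_gt0// divr_gt0.
  - move=> j; rewrite ler_pM2r ?invr_gt0//; apply: vol_le_ball => //.
      by have := rj0 j; lra.
    by move=> t; rewrite !ballEmdist /= => /lt_trans; apply.
  - rewrite ler_pdivrMr// mul1r; apply: vol_le_ball => //.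
    by apply: subset_trans (sub w xw).
  move=> j.
  have diff : rj j - rj j.+1 = rho / 2 / 2 * (2 ^+ j)^-1.
    by rewrite /rj exprS invfM; field; rewrite gt_eqF// exprn_gt0.
  have := W x r w (rj j.+1) (rj j) (ball z rho) r0 rd.
  have -> : r / (rj j - rj j.+1) = 24 / la * 2 ^+ j.
    rewrite diff /rho; field; rewrite !gt_eqF// ?exprn_gt0//.
  have -> : C * (24 / la * 2 ^+ j) `^ q = D * (2 ^+ j) `^ q.
    by rewrite powRM ?exprn_ge0// ?mulrA// divr_ge0// ltW.
  have -> : vol (ball x r) / r `^ s * (vol (ball w (rj j)) / vol (ball x r)) =
    vol (ball w (rj j)) / r `^ s by field; rewrite !gt_eqF.
  apply.
  - by have := rj0 j.+1; lra.
  - rewrite -subr_gt0 diff; have := pj j; nra.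
  - have := rjr j; rewrite /rho; lra.
  - by apply: subset_trans (sub w xw).
  - exact: mb.
  - move=> t zt; split; first exact: (sub z xz).
    move: zt; rewrite !ballEmdist /= => zt wt.
    have := metric_triangle w t z; rewrite (metric_sym t z); have := rjr j; lra.
  - by apply: le_trans wzv; apply: vol_le_ball.
have [xyv|/ltW xyv] := leP (vol (ball x rho)) (vol (ball y rho)).
  by apply: (key x y) => //; rewrite ?mdistxx /rho; lra.
by apply: (key y x) => //; rewrite ?mdistxx ?(metric_sym y x) /rho; lra.
Qed.

End lower_volume_bounds.

(** * From each embedding back to the volume bound *)

Section embeddings.
Context {R : realType} {d : measure_display} {X : borelMetricType d R}.
Variable mu : {measure set X -> \bar R}.
Implicit Types (x y z w : X) (r p q : R) (A B F N Omega : set X) (u g h : X -> R).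
Local Notation vol := (vol mu).

(** This and the next four definitions are the bodies of (a) to (e) with the constants as
    parameters, so that each implication can be treated for given constants. *)
Definition volume_bound (s kappa : R) : Prop :=
  forall (x : X) (r : R), 0 < r -> (r%:E <= diam X)%E ->
    ((kappa * r `^ s)%:E <= mu (ball x r))%E.

Definition sobolev_embedding (sigma s p C : R) : Prop :=
  forall (x0 : X) (R0 : R), 0 < R0 -> (R0%:E <= diam X)%E ->
  let B0 := ball x0 R0 in
  let sB0 := ball x0 (sigma * R0) in
  forall u g : X -> R, hajlasz_sobolev mu sB0 p u ->
    hajlasz_gradients mu sB0 p u g ->
    (average_norm mu B0 (sobolev_conjugate s p) u <=
     (C * (fine (mu sB0) / R0 `^ s) `^ p^-1)%:E *
     (R0%:E * average_norm mu sB0 p g + average_norm mu sB0 p u))%E.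

Definition sobolev_poincare (sigma s p C : R) : Prop :=
  forall (x0 : X) (R0 : R), 0 < R0 -> (R0%:E <= diam X)%E ->
  let B0 := ball x0 R0 in
  let sB0 := ball x0 (sigma * R0) in
  forall u g : X -> R, hajlasz_sobolev mu sB0 p u ->
    hajlasz_gradients mu sB0 p u g ->
    (ereal_inf [set average_norm mu B0 (sobolev_conjugate s p)
                      (fun x => (u x - gamma)%R) | gamma in [set: R]] <=
     (C * (fine (mu sB0) / R0 `^ s) `^ p^-1)%:E *
     (R0%:E * average_norm mu sB0 p g))%E.

Definition trudinger (sigma s C1 C2 gamma : R) : Prop :=
  forall (x0 : X) (R0 : R), 0 < R0 -> (R0%:E <= diam X)%E ->
  let B0 := ball x0 R0 in
  let sB0 := ball x0 (sigma * R0) in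
  forall u g : X -> R, hajlasz_sobolev mu sB0 s u ->
    hajlasz_gradients_pos mu sB0 s u g ->
    mu.-integrable B0 (EFin \o u) /\
    let uB0 := fine (average mu B0 (EFin \o u)) in
    (average mu B0 (fun x =>
       (expR ((C1 * (`|u x - uB0| / fine (Lp_norm mu sB0 s g))) `^ gamma))%:E)
     <= C2%:E)%E.

Definition morrey (s p C : R) : Prop :=
  forall u : X -> R, hajlasz_sobolev mu [set: X] p u ->
    (forall g : X -> R, hajlasz_gradients mu [set: X] p u g ->
       exists v : X -> R, {ae mu, forall x, v x = u x} /\
         forall x y : X, `|v x - v y| <=
           C * mdist x y `^ (1 - s / p) * fine (Lp_norm mu [set: X] p g)) /\
    (exists v : X -> R, {ae mu, forall x, v x = u x} /\
       exists K : R, forall x y : X,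
         `|v x - v y| <= K * mdist x y `^ (1 - s / p)).

Lemma ball_subset_dilate (sigma : R) x r : 1 < sigma -> 0 < r ->
  ball x r `<=` ball x (sigma * r).
Proof.
move=> sigma1 r0 y; rewrite !ballEmdist /= => /lt_trans; apply.
by rewrite ltr_pMl.
Qed.

Lemma conjugate_gt0 (s p : R) : 0 < p -> p < s -> 0 < sobolev_conjugate s p.
Proof. by move=> p0 ps; rewrite divr_gt0 ?mulr_gt0 ?subr_gt0//; exact: lt_trans ps. Qed.

(** This ratio serves as the exponent [tau]: the gain of p* over p is what makes the recursion
    superlinear. *)
Lemma conjugate_div (s p : R) : 0 < p -> p < s -> 1 < sobolev_conjugate s p / p.
Proof.
move=> p0 ps; rewrite /sobolev_conjugate.
rewrite (_ : s * p / (s - p) / p = s / (s - p)).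
  by rewrite ltr_pdivlMr ?subr_gt0// mul1r; lra.
by field; rewrite subr_eq0 !gt_eqF.
Qed.

(** With [V] the measure of the dilated ball: the prefactor in (b) and (c) cancels the averaging,
    and only the power of the radius remains. *)
Lemma volume_normalize (V W Rs a : R) : 0 < V -> 0 <= W -> 0 < Rs ->
  (V / Rs) `^ a * (V^-1 `^ a * W `^ a) = (W / Rs) `^ a.
Proof.
move=> V0 W0 Rs0; rewrite -!powRM ?mulr_ge0 ?divr_ge0 ?invr_ge0 ?(ltW V0) ?(ltW Rs0)//.
by congr (_ `^ _); field; rewrite !gt_eqF.
Qed.

Hypothesis mmX : metric_measure_space mu.

Let ball_measurable := @measurable_metric_ball _ _ X.

(** Raising the hypothesis to the power p* brings it into the form of the recursion. The factor 1/2
    comes from the oscillation of the cutoff around a constant. *)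
Lemma cutoff_estimate_of_norm (s p C : R) : 0 < p -> p < s -> 0 < C ->
  (forall x0 (R0 : R) w r' r F, 0 < R0 -> (R0%:E <= diam X)%E ->
    0 < r' -> r' < r -> r <= R0 -> ball w r `<=` ball x0 R0 -> measurable F ->
    F `<=` ball x0 R0 `\` ball w r -> vol (ball w r') <= vol F ->
    2^-1 * (vol (ball w r') / vol (ball x0 R0)) `^ (sobolev_conjugate s p)^-1 <=
    C * (R0 / (r - r')) * (vol (ball w r) / R0 `^ s) `^ p^-1) ->
  exists2 D : R, 0 < D & cutoff_estimate mu s (sobolev_conjugate s p / p)
    (sobolev_conjugate s p) D.
Proof.
move=> p0 ps C0; set q := sobolev_conjugate s p => hyp.
have q0 : 0 < q by exact: conjugate_gt0.
exists ((2 * C) `^ q); first by rewrite powR_gt0 ?mulr_gt0.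
move=> x0 R0 w r' r F R00 Rd r'0 r'r rR BB mF FB vF.
have := hyp x0 R0 w r' r F R00 Rd r'0 r'r rR BB mF FB vF.
have V0 := vol_ball_gt0 mmX x0 R00.
have L0 : 0 < R0 / (r - r') by rewrite divr_gt0 ?subr_gt0.
have Rs0 : 0 < R0 `^ s by rewrite powR_gt0.
have W0 : 0 <= vol (ball w r) / R0 `^ s by rewrite divr_ge0 ?vol_ge0 ?(ltW Rs0).
have W'0 : 0 <= vol (ball w r') / vol (ball x0 R0).
  by rewrite divr_ge0 ?vol_ge0.
move: W0 W'0; set W' := vol (ball w r') / _; set W := vol (ball w r) / _.
set L := R0 / _ in L0 * => W0 W'0 h.
have h2 : W' `^ q^-1 <= 2 * C * L * W `^ p^-1 by lra.
have := @le_powR _ q _ _ (ltW q0) (powR_ge0 _ _) h2.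
rewrite powRVK ?gt_eqF// => /le_trans; apply.
have C20 : 0 <= 2 * C by lra.
have CL0 : 0 <= 2 * C * L by apply: mulr_ge0 => //; exact: ltW.
rewrite (powRM q CL0) ?powR_ge0// (powRM q C20) ?(ltW L0)//.
by rewrite -[(W `^ _) `^ q]powRrM (mulrC p^-1).
Qed.

(** A constant cannot be close to both 0 and 1: for gamma <= 1/2 the inner ball serves, where the
    cutoff is 1, and otherwise [F], where it is 0. *)
Lemma exists_cutoff_oscillation x0 (R0 : R) w r' r F (gamma : R) :
  r' < r ->
  ball w r `<=` ball x0 R0 -> measurable F ->
  F `<=` ball x0 R0 `\` ball w r -> vol (ball w r') <= vol F ->
  exists F' : set X, [/\ measurable F', F' `<=` ball x0 R0,
    vol (ball w r') <= vol F' &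
    forall x, F' x -> 2^-1 <= `|cutoff w r' r x - gamma|].
Proof.
move=> r'r BB mF FB vF.
have [g12|g12] := leP gamma 2^-1.
  exists (ball w r'); split => //.
    apply: subset_trans BB => x; rewrite !ballEmdist /= => /lt_trans; exact.
  move=> x xB; rewrite cutoff_eq1//; apply: le_trans (ler_norm _); lra.
exists F; split => //; first by move=> x /FB[].
move=> x /FB[_ xB]; rewrite cutoff_eq0// sub0r normrN.
by apply: le_trans (ler_norm _); exact: ltW.
Qed.

Lemma poincare_cutoff_estimate (sigma s p C : R) : 1 < sigma -> 0 < p -> p < s ->
  0 < C -> sobolev_poincare sigma s p C ->
  exists2 D : R, 0 < D & cutoff_estimate mu s (sobolev_conjugate s p / p)
    (sobolev_conjugate s p) D.
Proof.
move=> sigma1 p0 ps C0 S; apply: (cutoff_estimate_of_norm p0 ps C0).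
move=> x0 R0 w r' r F R00 Rd r'0 r'r rR BB mF FB vF.
have r0 : 0 < r by lra.
have q0 := conjugate_gt0 p0 ps; set q := sobolev_conjugate s p in q0 *.
have sR0 : 0 < sigma * R0 by rewrite mulr_gt0//; lra.
have BsB : ball w r `<=` ball x0 (sigma * R0).
  by apply: subset_trans BB _; exact: ball_subset_dilate.
have V0 := vol_ball_gt0 mmX x0 R00.
rewrite -lee_fin.
have := S x0 R0 R00 Rd _ _
  (cutoff_sobolev mmX r'r r0 p0 (ball_measurable _ _) BsB)
  (cutoff_gradients mmX r'r r0 p0 (ball_measurable _ _) BsB).
rewrite (average_norm_Lp p0 _ (integral_cutoff_slope mmX r'r r0 p0 (ball_measurable _ _) BsB)); last first.
  by rewrite mulr_ge0 ?powR_ge0// invr_ge0 subr_ge0 ltW.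
rewrite -!EFinM -/(vol _).
rewrite [X in (_ <= X%:E)%E -> _](_ : _ = C * (R0 / (r - r')) * (vol (ball w r) / R0 `^ s) `^ p^-1); last first.
  rewrite -(@volume_normalize (vol (ball x0 (sigma * R0)))) ?vol_ge0 ?powR_gt0 ?vol_ball_gt0//.
  by ring.
apply: le_trans.
(* The set [F'] may depend on [gamma], but the resulting lower bound does not. *)
apply: le_ereal_inf_tmp => _ [gamma _ <-].
have [F' [mF' F'B vF' uF']] := exists_cutoff_oscillation gamma r'r BB mF FB vF.
apply: (@le_trans _ _ (2^-1 * (vol F' / vol (ball x0 R0)) `^ q^-1)%:E).
  rewrite lee_fin ler_wpM2l ?invr_ge0//; apply: le_powR.
  - by rewrite invr_ge0 ltW.
  - by rewrite divr_ge0 ?vol_ge0.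
  - by rewrite ler_pM2r ?invr_gt0.
apply: average_norm_ge => //.
- exact: mu_ball_lty.
- by apply: measurable_funB; [exact: measurable_cutoff|exact: measurable_cst].
Qed.

Lemma embedding_cutoff_estimate (sigma s p C : R) : 1 < sigma -> 0 < p -> p < s ->
  0 < C -> sobolev_embedding sigma s p C ->
  exists2 D : R, 0 < D & cutoff_estimate mu s (sobolev_conjugate s p / p)
    (sobolev_conjugate s p) D.
Proof.
move=> sigma1 p0 ps C0 S; have C20 : 0 < 2 * C by lra.
apply: (cutoff_estimate_of_norm p0 ps C20).
move=> x0 R0 w r' r F R00 Rd r'0 r'r rR BB mF FB vF.
have r0 : 0 < r by lra.
have q0 := conjugate_gt0 p0 ps; set q := sobolev_conjugate s p in q0 *.
have sR0 : 0 < sigma * R0 by rewrite mulr_gt0//; lra.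
have BsB : ball w r `<=` ball x0 (sigma * R0).
  by apply: subset_trans BB _; exact: ball_subset_dilate.
have V0 := vol_ball_gt0 mmX x0 R00.
have S0 := vol_ball_gt0 mmX x0 sR0.
have uS := cutoff_sobolev mmX r'r r0 p0 (ball_measurable _ _) BsB.
have := S x0 R0 R00 Rd _ _ uS
  (cutoff_gradients mmX r'r r0 p0 (ball_measurable _ _) BsB).
rewrite (average_norm_Lp p0 _ (integral_cutoff_slope mmX r'r r0 p0 (ball_measurable _ _) BsB)); last first.
  by rewrite mulr_ge0 ?powR_ge0// invr_ge0 subr_ge0 ltW.
have [A [A0 _ uA]] := LpP p0 uS.1.
rewrite (average_norm_Lp p0 A0 uA) -/(vol _).
have AW : A <= vol (ball w r) `^ p^-1.
  rewrite -[leLHS](@powRK _ p) ?gt_eqF//; apply: le_powR; rewrite ?invr_ge0 ?powR_ge0 ?(ltW p0)//.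
  rewrite -lee_fin -uA; exact: integral_cutoff_le.
have wB : ball w r' `<=` ball x0 R0.
  apply: subset_trans BB => x; rewrite !ballEmdist /= => /lt_trans; exact.
have low : ((1 * (vol (ball w r') / vol (ball x0 R0)) `^ q^-1)%:E <=
    average_norm mu (ball x0 R0) q (cutoff w r' r))%E.
  apply: average_norm_ge => //; first exact: mu_ball_lty.
    exact: measurable_cutoff.
  by move=> x xB; rewrite cutoff_eq1// normr1.
move=> /(le_trans low); rewrite -?EFinM lee_fin mul1r => h.
(* As this ratio is at least 1, the zero-order term is absorbed into the gradient term; this
   accounts for the constant 2 C. *)
have L1 : 1 <= R0 / (r - r') by rewrite ler_pdivlMr ?subr_gt0// mul1r; lra.
rewrite -(@volume_normalize (vol (ball x0 (sigma * R0))) (vol (ball w r))) ?vol_ge0 ?powR_gt0//.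
set P := (vol (ball x0 (sigma * R0)) / _) `^ _ in h *.
set Q := (vol (ball x0 (sigma * R0)))^-1 `^ _ in h *.
set W := vol (ball w r) `^ _ in h AW *; set L := R0 / _ in L1 *.
have P0 : 0 <= P := powR_ge0 _ _.
have Q0 : 0 <= Q := powR_ge0 _ _.
have W0 : 0 <= W := powR_ge0 _ _.
apply: (@le_trans _ _ (C * P * (L * (Q * W) + Q * W))).
  apply: (@le_trans _ _ (((vol (ball w r') / vol (ball x0 R0)) `^ q^-1))).
    by rewrite ler_piMl ?powR_ge0// invf_le1// ler1n.
  apply: (le_trans h); apply: ler_wpM2l; first by rewrite mulr_ge0// ltW.
  apply: lerD; last by rewrite ler_wpM2l.
  by rewrite /L le_eqVlt; apply/orP; left; apply/eqP; ring.
have : C * P * (Q * W) <= C * P * (Q * W) * L.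
  by rewrite ler_peMr// !mulr_ge0// ltW.
lra.
Qed.

Lemma trudinger_cutoff_estimate (sigma s C1 C2 gamma : R) : 1 < sigma -> 0 < s ->
  0 < C1 -> 0 < C2 -> 0 < gamma -> trudinger sigma s C1 C2 gamma ->
  exists tau q D : R, [/\ 1 < tau, 0 < q, 0 < D & cutoff_estimate mu s tau q D].
Proof.
move=> sigma1 s0 C10 C20 g0 S.
(* The term of order n + 1 of the exponential series is a power q > s of the oscillation, which
   yields tau = q / s > 1. *)
pose n := Num.truncn (s / gamma); pose q := gamma * n.+1%:R.
have sq : s < q.
  rewrite /q mulrC -ltr_pdivrMr//; apply: (truncnS_gt (s / gamma)).
have q0 : 0 < q by exact: lt_trans sq.
pose D := C2 * (n.+1)`!%:R * (2 / C1) `^ q.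
have D0 : 0 < D by rewrite !mulr_gt0 ?powR_gt0 ?divr_gt0// ltr0n fact_gt0.
exists (q / s), q, D; split => //; first by rewrite ltr_pdivlMr// mul1r.
move=> x0 R0 w r' r F R00 Rd r'0 r'r rR BB mF FB vF.
have r0 : 0 < r by lra.
have sR0 : 0 < sigma * R0 by rewrite mulr_gt0//; lra.
have BsB : ball w r `<=` ball x0 (sigma * R0).
  by apply: subset_trans BB _; exact: ball_subset_dilate.
have V0 := vol_ball_gt0 mmX x0 R00.
have W0 := vol_ball_gt0 mmX w r0.
have nE := Lp_norm_cutoff_slope mmX r'r r0 s0 (ball_measurable _ _) BsB.
pose G := (r - r')^-1 * vol (ball w r) `^ s^-1.
have L0 : 0 < (r - r')^-1 by rewrite invr_gt0 subr_gt0.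
have G0 : 0 < G by rewrite mulr_gt0 ?powR_gt0.
have gS : hajlasz_gradients_pos mu (ball x0 (sigma * R0)) s (cutoff w r' r)
    (cutoff_slope w r' r).
  split; last by rewrite nE lte_fin.
  exact: (cutoff_gradients mmX r'r r0 s0 (ball_measurable _ _) BsB).
have [_ /=] := S x0 R0 R00 Rd _ _
  (cutoff_sobolev mmX r'r r0 s0 (ball_measurable _ _) BsB) gS.
rewrite nE /= -/G; set uB := fine _ => avg.
have [F' [mF' F'B vF' uF']] := exists_cutoff_oscillation uB r'r BB mF FB vF.
(* [H] is a lower bound for the exponential on [F'], where the cutoff is at least 1/2 away from its
   average. *)
pose H := (C1 / (2 * G)) `^ q / (n.+1)`!%:R.
have H0 : 0 < H.
  by apply: divr_gt0; rewrite ?ltr0n ?fact_gt0// powR_gt0// divr_gt0// mulr_gt0.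
have low : H * (vol F' / vol (ball x0 R0)) <= C2.
  rewrite -lee_fin; apply: le_trans avg; apply: average_ge => //.
  - exact: ltW.
  - exact: mu_ball_lty.
  - apply: measurableT_comp; first exact: measurable_expR.
    apply: (measurableT_comp (measurable_powR gamma)).
    apply: measurable_funM; first exact: measurable_cst.
    apply: measurable_funM; last exact: measurable_cst.
    apply: measurableT_comp => //.
    by apply: measurable_funB; [exact: measurable_cutoff|exact: measurable_cst].
  move=> x /uF' ux.
  set t := C1 * _.
  have t0 : C1 / (2 * G) <= t.
    by rewrite /t invfM mulrA -[leLHS]mulrA ler_pM2l// ler_pM2r ?invr_gt0.
  apply: le_trans (_ : 1 + (t `^ gamma) ^+ n.+1 / (n.+1)`!%:R <= _); last first.
    exact: expR_ge1Dxn (powR_ge0 _ _).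
  rewrite -powR_mulrn ?powR_ge0// -powRrM -/q.
  apply: (@le_trans _ _ (t `^ q / (n.+1)`!%:R)); last by rewrite lerDr.
  rewrite ler_pM2r ?invr_gt0 ?ltr0n ?fact_gt0//; apply: le_powR => //; first exact: ltW.
  by apply: ltW; rewrite divr_gt0// mulr_gt0.
have {}low : H * (vol (ball w r') / vol (ball x0 R0)) <= C2.
  by apply: le_trans low; rewrite ler_pM2l// ler_pM2r ?invr_gt0.
(* The remaining comparison is an equality: since tau = q / s, the powers of [R0] cancel. *)
rewrite mulrC -ler_pdivlMr// in low; apply: (le_trans low); rewrite le_eqVlt.
apply/orP; left; apply/eqP.
have -> : C2 / H = D * G `^ q.
  rewrite /H /D !powR_div ?(ltW C10)//; last by rewrite mulr_ge0 ?(ltW G0).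
  rewrite powRM ?(ltW G0)//; field.
  by rewrite !gt_eqF ?powR_gt0 ?ltr0n ?fact_gt0.
rewrite -[RHS]mulrA; congr (_ * _).
have Rs0 : 0 < R0 `^ s by rewrite powR_gt0.
have eR : (R0 `^ s) `^ (q / s) = R0 `^ q.
  by rewrite -powRrM; congr (_ `^ _); field; rewrite gt_eqF.
rewrite [(vol (ball w r) / _) `^ _]powR_div ?(ltW W0) ?(ltW Rs0)// eR powRM ?(ltW R00) ?(ltW L0)//.
rewrite /G powRM ?powR_ge0 ?(ltW L0)// -powRrM (mulrC s^-1).
by field; rewrite gt_eqF ?powR_gt0.
Qed.

Lemma ae_exists_in_ball (P : X -> Prop) x r : {ae mu, forall y, P y} -> 0 < r ->
  exists2 z, ball x r z & P z.
Proof.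
move=> [N [mN N0 PN]] r0; apply: contrapT => hz.
have /(subset_measure0 (ball_measurable x r) mN)/(_ N0) : ball x r `<=` N.
  by move=> z xz; apply: PN => Pz; apply: hz; exists z.
by move=> h; have := vol_ball_gt0 mmX x r0; rewrite /vol h /= ltxx.
Qed.

(** A cutoff around [x] drops from 1 to 0 within distance [r], while the norm of its slope is
    controlled by the measure of [ball x r]; a small measure would contradict Hölder continuity. *)
Lemma morrey_volume (s p C : R) : uniformly_perfect X -> 0 < s -> s < p -> 0 < C ->
  morrey s p C -> exists kappa : R, 0 < kappa /\ volume_bound s kappa.
Proof.
move=> [la [la0 la1 up]] s0 sp C0 M.
have p0 : 0 < p by exact: lt_trans sp.
(* The cutoff below has slope 1 / (rho / 2) = 12 / (la r), which gives the 12. *)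
exists ((la / (12 * C)) `^ p); split; first by rewrite powR_gt0 ?divr_gt0 ?mulr_gt0.
move=> x r r0 rd; rewrite mu_ballE// lee_fin.
have [y /andP[y1 y2]] := annulus_point la0 la1 up x r0 rd.
pose rho := la * r / 6.
have rho0 : 0 < rho by rewrite /rho !mulr_gt0.
have lr : la * r < r by rewrite gtr_pMl.
have r'0 : 0 < rho / 2 by lra.
have r'r : rho / 2 < rho by lra.
have mT : measurable [set: X] by [].
have [H _] := M _ (cutoff_sobolev mmX r'r rho0 p0 mT (@subsetT _ (ball x rho))).
have [v [vu]] := H _ (cutoff_gradients mmX r'r rho0 p0 mT (@subsetT _ (ball x rho))).
rewrite (Lp_norm_cutoff_slope mmX r'r rho0 p0 mT (@subsetT _ (ball x rho))) /= => hv.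
(* The Hölder representative agrees with the cutoff only almost everywhere, so the two evaluation
   points are chosen inside balls where the cutoff is constantly 1 and 0. *)
have [x' xx' vx'] := ae_exists_in_ball x vu r'0.
have [y' yy' vy'] := ae_exists_in_ball y vu rho0.
have := hv x' y'; rewrite vx' vy' cutoff_eq1// (cutoff_eq0 r'r); last first.
  move: yy'; rewrite !ballEmdist /= => yy' xy'.
  have := metric_triangle x y' y; rewrite (metric_sym y' y) /rho in yy' xy' *; lra.
rewrite subr0 normr1 => h.
have dr : mdist x' y' <= r.
  move: xx' yy'; rewrite !ballEmdist /= => xx' yy'.
  have := metric_triangle x' x y'; have := metric_triangle x y y'.
  rewrite (metric_sym x' x) /rho in xx' yy' *; lra.
have sp1 : 0 <= 1 - s / p by rewrite subr_ge0 ler_pdivrMr// mul1r ltW.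
have dr' := le_powR sp1 (mdist_ge0 _ _) dr.
have V0 := vol_ball_gt0 mmX x r0.
have vV : vol (ball x rho) `^ p^-1 <= vol (ball x r) `^ p^-1.
  apply: le_powR; rewrite ?invr_ge0 ?vol_ge0 ?(ltW p0)//.
  apply: vol_le_ball => // z; rewrite !ballEmdist /= => /lt_trans; apply.
  rewrite /rho; lra.
have rr : r `^ (1 - s / p) = r / r `^ (s / p).
  by rewrite powRB ?powRr1 ?(ltW r0)//; apply/implyP => _; rewrite gt_eqF.
have rsp : 0 < r `^ (s / p) by rewrite powR_gt0.
have key : (la / (12 * C)) * r `^ (s / p) <= vol (ball x r) `^ p^-1.
  have : 1 <= C * (r / r `^ (s / p)) * ((rho - rho / 2)^-1 * vol (ball x r) `^ p^-1).
    apply: (le_trans h); apply: ler_pM.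
    - by rewrite mulr_ge0 ?powR_ge0 ?(ltW C0).
    - by rewrite mulr_ge0 ?powR_ge0// invr_ge0; lra.
    - by rewrite ler_pM2l// -rr.
    - by rewrite ler_pM2l// invr_gt0; lra.
  have -> : C * (r / r `^ (s / p)) * ((rho - rho / 2)^-1 * vol (ball x r) `^ p^-1) =
     vol (ball x r) `^ p^-1 / ((la / (12 * C)) * r `^ (s / p)).
    rewrite /rho; field; rewrite !gt_eqF//; have : 0 < la * r by exact: mulr_gt0.
    by lra.
  by rewrite ler_pdivlMr ?mul1r// !mulr_gt0// invr_gt0 mulr_gt0.
have k0 : 0 <= la / (12 * C) by rewrite divr_ge0 ?mulr_ge0 ?(ltW la0) ?(ltW C0).
have := le_powR (ltW p0) (mulr_ge0 k0 (ltW rsp)) key.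
rewrite powRVK ?gt_eqF ?(ltW V0)// (powRM p k0) ?(ltW rsp)//.
by rewrite -(powRrM r) divfK ?gt_eqF.
Qed.

End embeddings.

(** * Pointwise oscillation bounds by chaining *)

Section chaining.
Context {R : realType} {d : measure_display} {X : borelMetricType d R}.
Implicit Types (x y z : X) (r K : R) (n : nat).

Variables (G : set X) (u g : X -> R).
Hypothesis g0 : forall x, G x -> 0 <= g x.
Hypothesis ug : forall x y, G x -> G y -> `|u x - u y| <= mdist x y * (g x + g y).

(* Chain good points of the balls of radius [r0 / 4 ^ n] around [x]; the
   increments of [S] majorize those of [u] along the chain. *)
Lemma chain_bound (T : R -> R) (S : nat -> R) x (r0 : R) : G x -> 0 < r0 ->
  (forall r, 0 < r -> r <= r0 -> exists z, [/\ ball x r z, G z & g z <= T r]) ->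
  (forall n, (r0 / 4 ^+ n + r0 / 4 ^+ n.+1) *
     (T (r0 / 4 ^+ n) + T (r0 / 4 ^+ n.+1)) <= S n.+1 - S n) ->
  exists z, [/\ ball x r0 z, G z, g z <= T r0 &
    forall n, `|u x - u z| <=
      r0 / 4 ^+ n * (g x + T (r0 / 4 ^+ n)) + (S n - S 0%N)].
Proof.
move=> Gx r00 sel hS.
have p4 n : 0 < 4 ^+ n :> R by rewrite exprn_gt0.
have rn0 n : 0 < r0 / 4 ^+ n by rewrite divr_gt0.
have rnr n : r0 / 4 ^+ n <= r0 by rewrite ler_piMr ?(ltW r00)// invf_le1// exprn_ege1// ler1n.
have /choice [z hz] n : exists z, [/\ ball x (r0 / 4 ^+ n) z, G z & g z <= T (r0 / 4 ^+ n)].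
  exact: sel.
have zb n : mdist x (z n) < r0 / 4 ^+ n by have [] := hz n; rewrite ballEmdist.
have Gz n : G (z n) by have [] := hz n.
have gz n : g (z n) <= T (r0 / 4 ^+ n) by have [] := hz n.
have [] := hz 0%N; rewrite expr0 divr1 => h1 h2 h3.
have T0 n : 0 <= T (r0 / 4 ^+ n) := le_trans (g0 (Gz n)) (gz n).
have hn n : `|u (z n) - u (z 0%N)| <= S n - S 0%N.
  elim: n => [|n IH]; first by rewrite !subrr normr0.
  have -> : u (z n.+1) - u (z 0%N) = (u (z n.+1) - u (z n)) + (u (z n) - u (z 0%N)).
    by ring.
  apply: le_trans (ler_normD _ _) _.
  have step : `|u (z n.+1) - u (z n)| <= S n.+1 - S n.
    apply: le_trans (hS n).
    have dz : mdist (z n.+1) (z n) <= r0 / 4 ^+ n + r0 / 4 ^+ n.+1.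
      apply: le_trans (metric_triangle _ x _) _; rewrite (metric_sym _ x) addrC.
      by apply: lerD; exact: ltW.
    apply: le_trans (ug (Gz n.+1) (Gz n)) _.
    by apply: ler_pM; rewrite ?mdist_ge0 ?addr_ge0 ?g0// addrC lerD.
  lra.
exists (z 0%N); split=> // n.
have -> : u x - u (z 0%N) = (u x - u (z n)) + (u (z n) - u (z 0%N)) by ring.
apply: le_trans (ler_normD _ _) _; apply: lerD => //.
apply: le_trans (ug Gx (Gz n)) _.
by apply: ler_pM; rewrite ?mdist_ge0 ?addr_ge0 ?g0 ?(ltW (zb n))// lerD2l.
Qed.

(** The stopping scale of a chain, where the term with [g x] has come down to the size of the
    selected values. Minimality of [n] gives the reverse inequality up to the factor [b], unless n =
    0. *)
Lemma first_small_scale (a K b : R) : 1 < b -> 0 < K ->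
  exists n : nat, a / b ^+ n <= K /\ (n = 0%N \/ K < b * (a / b ^+ n)).
Proof.
move=> b1 K0; have b0 : 0 < b by lra.
have ex : exists n : nat, a / b ^+ n <= K.
  have [a0|a0] := leP a 0.
    by exists 0%N; rewrite expr0 divr1; apply: le_trans a0 (ltW K0).
  have bV1 : b^-1 < 1 by rewrite invf_lt1.
  have bV0 : 0 <= b^-1 by rewrite invr_ge0 ltW.
  have [n hn] := exists_expr_lt bV0 bV1 (divr_gt0 K0 a0).
  by exists n; rewrite -exprVn mulrC -ler_pdivlMr// ltW.
case: (ex_minnP ex) => [[|n] hn min]; first by exists 0%N; split => //; left.
exists n.+1; split => //; right.
have -> : b * (a / b ^+ n.+1) = a / b ^+ n.
  by rewrite exprS; field; rewrite !gt_eqF// exprn_gt0.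
by rewrite ltNge; apply/negP => /min; rewrite ltnn.
Qed.

(** The case s / p = 2: the increments grow like 4^n, so the chain is stopped as soon as r0^2 g(x) /
    16^n is at most [K]. *)
Lemma pointwise_subcritical x (r0 : R) K : G x -> 0 < r0 -> 0 < K ->
  (forall r, 0 < r -> r <= r0 ->
     exists z, [/\ ball x r z, G z & g z <= K / r ^+ 2]) ->
  exists z, [/\ ball x r0 z, G z, g z <= K / r0 ^+ 2 &
    `|u x - u z| ^+ 2 <= 100 * ((K / r0) ^+ 2 + 16 * (K * g x))].
Proof.
move=> Gx r00 K0 sel; have gx := g0 Gx.
have p4 n : 0 < 4 ^+ n :> R by rewrite exprn_gt0.
(* The increments to be majorized are 85/4 times K 4^n / r0, and those of [S] are 24 times it. *)
pose S n := 8 * K * (4 ^+ n / r0).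
have [n|z [z1 z2 z3 hz]] := @chain_bound (fun r => K / r ^+ 2) S x r0 Gx r00 sel.
  have -> : (r0 / 4 ^+ n + r0 / 4 ^+ n.+1) *
    (K / (r0 / 4 ^+ n) ^+ 2 + K / (r0 / 4 ^+ n.+1) ^+ 2) =
    (85 / 4) * (K * (4 ^+ n / r0)).
    by rewrite exprS; field; rewrite !gt_eqF.
  rewrite /S exprS.
  have : 0 < K * (4 ^+ n / r0) by rewrite mulr_gt0// divr_gt0.
  lra.
exists z; split=> //.
have sixteen1 : 1 < 16 :> R by rewrite ltr1n.
have [n [n1 n2]] := first_small_scale (r0 ^+ 2 * g x) sixteen1 K0.
have e16 : 16 ^+ n = 4 ^+ n * 4 ^+ n :> R by rewrite -exprMn; congr (_ ^+ _); ring.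
pose q := K * (4 ^+ n / r0).
have q0 : 0 < q by rewrite mulr_gt0 ?divr_gt0.
have hq : `|u x - u z| <= 10 * q.
  apply: le_trans (hz n) _.
  have -> : r0 / 4 ^+ n * (g x + K / (r0 / 4 ^+ n) ^+ 2) + (S n - S 0%N) =
    (r0 ^+ 2 * g x / 16 ^+ n) * (4 ^+ n / r0) + 9 * q - 8 * K / r0.
    by rewrite /S /q e16 expr0; field; rewrite !gt_eqF.
  have : r0 ^+ 2 * g x / 16 ^+ n * (4 ^+ n / r0) <= q.
    by rewrite /q ler_pM2r// divr_gt0.
  have : 0 < K / r0 by rewrite divr_gt0.
  lra.
(* If n = 0 then q = K / r0; otherwise the scale before [n] was still too large, which bounds q^2 by
   16 K g(x). *)
have hq2 : q ^+ 2 <= (K / r0) ^+ 2 + 16 * (K * g x).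
  case: n2 => [n0|n2].
    rewrite /q n0 expr0 div1r lerDl mulr_ge0// mulr_ge0// ltW//.
  apply: (@le_trans _ _ (16 * (K * g x))); last by rewrite lerDr sqr_ge0.
  have -> : 16 * (K * g x) = (16 * (r0 ^+ 2 * g x / 16 ^+ n)) * (K * (16 ^+ n / r0 ^+ 2)).
    by rewrite e16; field; rewrite !gt_eqF.
  have -> : q ^+ 2 = K * (K * (16 ^+ n / r0 ^+ 2)).
    by rewrite /q e16; field; rewrite !gt_eqF.
  rewrite ler_pM2r ?(ltW n2)// mulr_gt0// divr_gt0 ?exprn_gt0//.
have := normr_ge0 (u x - u z); nra.
Qed.

(** The case s = p: every scale contributes the same multiple of [K], so the bound is linear in the
    number [n] of scales, that is, logarithmic in r0 g(x) / K. *)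
Lemma pointwise_critical x (r0 : R) K : G x -> 0 < r0 -> 0 < K ->
  (forall r, 0 < r -> r <= r0 ->
     exists z, [/\ ball x r z, G z & g z <= K / r]) ->
  exists z n, [/\ ball x r0 z, G z, g z <= K / r0,
    `|u x - u z| <= K * (2 + 7 * n%:R) & 4 ^+ n <= 1 + 4 * r0 * g x / K].
Proof.
move=> Gx r00 K0 sel; have gx := g0 Gx.
have p4 n : 0 < 4 ^+ n :> R by rewrite exprn_gt0.
pose S n : R := 7 * K * n%:R.
have [n|z [z1 z2 z3 hz]] := @chain_bound (fun r => K / r) S x r0 Gx r00 sel.
  have -> : (r0 / 4 ^+ n + r0 / 4 ^+ n.+1) *
    (K / (r0 / 4 ^+ n) + K / (r0 / 4 ^+ n.+1)) = (25 / 4) * K.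
    by rewrite exprS; field; rewrite !gt_eqF.
  rewrite /S -natr1; lra.
have four1 : 1 < 4 :> R by rewrite ltr1n.
have [n [n1 n2]] := first_small_scale (r0 * g x) four1 K0.
exists z, n; split=> //.
  apply: le_trans (hz n) _.
  have -> : r0 / 4 ^+ n * (g x + K / (r0 / 4 ^+ n)) + (S n - S 0%N) =
    r0 * g x / 4 ^+ n + K + 7 * K * n%:R.
    by rewrite /S; field; rewrite !gt_eqF.
  lra.
have h0 : 0 <= 4 * r0 * g x / K.
  by apply: divr_ge0; [rewrite mulr_ge0// mulr_ge0// ltW|exact: ltW].
case: n2 => [->|n2]; first by rewrite expr0 lerDl.
have : 4 ^+ n <= 4 * r0 * g x / K.
  rewrite ler_pdivlMr//.
  have := ltW n2; rewrite -(ler_pM2l (p4 n)); congr (_ <= _); field.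
  by rewrite gt_eqF.
lra.
Qed.

(** The case s / p = 1/2: the increments decay like 2^(-n), so the chain can be continued to the
    limit, where [g x] drops out. *)
Lemma pointwise_supercritical x (r0 : R) K : G x -> 0 < r0 -> 0 < K ->
  (forall r, 0 < r -> r <= r0 ->
     exists z, [/\ ball x r z, G z & g z <= K / Num.sqrt r]) ->
  exists z, [/\ ball x r0 z, G z, g z <= K / Num.sqrt r0 &
    `|u x - u z| <= 8 * K * Num.sqrt r0].
Proof.
move=> Gx r00 K0 sel; have gx := g0 Gx.
have p4 n : 0 < 4 ^+ n :> R by rewrite exprn_gt0.
have p2 n : 0 < 2 ^+ n :> R by rewrite exprn_gt0.
have s0 : 0 < Num.sqrt r0 by rewrite sqrtr_gt0.
have e4 n : 4 ^+ n = 2 ^+ n * 2 ^+ n :> R by rewrite -exprMn; congr (_ ^+ _); ring.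
have sq n : Num.sqrt (r0 / 4 ^+ n) = Num.sqrt r0 / 2 ^+ n.
  have -> : r0 / 4 ^+ n = r0 * ((2 ^+ n)^-1) ^+ 2.
    by rewrite e4; field; rewrite !gt_eqF.
  by rewrite sqrtrM ?(ltW r00)// sqrtr_sqr ger0_norm// invr_ge0 ltW.
have er : r0 = Num.sqrt r0 * Num.sqrt r0 by rewrite -expr2 sqr_sqrtr// ltW.
(* [S] increases to 0, so the total variation along the chain is at most -S(0). *)
pose S n : R := - (8 * K * (Num.sqrt r0 / 2 ^+ n)).
have [n|z [z1 z2 z3 hz]] := @chain_bound (fun r => K / Num.sqrt r) S x r0 Gx r00 sel.
  rewrite !sq; have -> : (r0 / 4 ^+ n + r0 / 4 ^+ n.+1) *
    (K / (Num.sqrt r0 / 2 ^+ n) + K / (Num.sqrt r0 / 2 ^+ n.+1)) =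
    (15 / 4) * (K * (Num.sqrt r0 / 2 ^+ n)).
    by rewrite [X in X / _ + X / _]er !e4 exprS; field; rewrite !gt_eqF.
  rewrite /S exprS invfM.
  have : 0 < K * (Num.sqrt r0 / 2 ^+ n) by rewrite mulr_gt0// divr_gt0.
  lra.
exists z; split=> //; apply/ler_addgt0Pr => e e0.
have half : 2^-1 < 1 :> R by rewrite invf_lt1// ltr1n.
have half0 : 0 <= 2^-1 :> R by rewrite invr_ge0.
(* Adding 1 keeps the divisor positive when [g x] vanishes. *)
have rg : 0 < r0 * g x + 1 by rewrite ltr_wpDl// mulr_ge0// ltW.
have [n hn] := exists_expr_lt half0 half (divr_gt0 e0 rg).
apply: le_trans (hz n) _; rewrite sq.
have -> : r0 / 4 ^+ n * (g x + K / (Num.sqrt r0 / 2 ^+ n)) + (S n - S 0%N) =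
  r0 * g x / 4 ^+ n + (8 * K * Num.sqrt r0 - 7 * (K * (Num.sqrt r0 / 2 ^+ n))).
  by rewrite /S [X in X / _ * _ + _]er [X in X * _ / _ + _]er !e4 expr0; field; rewrite !gt_eqF.
have : 0 < K * (Num.sqrt r0 / 2 ^+ n) by rewrite mulr_gt0// divr_gt0.
have : r0 * g x / 4 ^+ n <= e.
  rewrite exprVn ltr_pdivlMr// in hn; apply: le_trans (ltW hn).
  rewrite mulrC; apply: ler_pM.
  - by rewrite invr_ge0 ltW.
  - by rewrite mulr_ge0// ltW.
  - by rewrite lef_pV2 ?posrE// e4 ler_peMl ?(ltW (p2 n))// exprn_ege1// ler1n.
  - by rewrite lerDl.
lra.
Qed.

End chaining.

(** * Selection of points from the volume bound, and integrated oscillation bounds on a ball *)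

Section volume_bound_consequences.
Context {R : realType} {d : measure_display} {X : borelMetricType d R}.
Variable mu : {measure set X -> \bar R}.
Implicit Types (x y z : X) (r p q K : R) (B N Omega : set X) (u g f h : X -> R).
Local Notation vol := (vol mu).

Lemma ae_off_null N (P : X -> Prop) : measurable N -> mu N = 0%E ->
  (forall x, ~ N x -> P x) -> {ae mu, forall x, P x}.
Proof.
move=> mN N0 h; exists N; split=> // x nP; apply: contrapT => /h Px; exact: nP.
Qed.

Lemma integral_affine_bound B N (F f : X -> R) (a b I : R) :
  measurable B -> mu B = (vol B)%:E -> measurable N -> mu N = 0%E ->
  0 <= a -> 0 <= b -> measurable_fun B F -> measurable_fun B f ->
  (forall x, 0 <= F x) -> (forall x, 0 <= f x) ->
  (\int[mu]_(x in B) (f x)%:E <= I%:E)%E ->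
  (forall x, B x -> ~ N x -> F x <= a + b * f x) ->
  (\int[mu]_(x in B) (F x)%:E <= (vol B * a + b * I)%:E)%E.
Proof.
move=> mB muB mN N0 a0 b0 mF mf F0 f0 fI Ff.
have mf' : measurable_fun B (EFin \o f) by exact/measurable_EFinP.
apply: (@le_trans _ _ (\int[mu]_(x in B) (a%:E + b%:E * (f x)%:E))%E).
  apply: ae_ge0_le_integral => //.
  - by move=> x _; rewrite lee_fin.
  - exact/measurable_EFinP.
  - by move=> x _; rewrite adde_ge0 ?mule_ge0 ?lee_fin.
  - apply: emeasurable_funD; first exact: measurable_cst.
    exact: measurable_funeM.
  apply: (ae_off_null mN N0) => x Nx Bx.
  by rewrite -EFinM -EFinD lee_fin; exact: Ff.
rewrite ge0_integralD//; first last.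
- exact: measurable_funeM.
- by move=> x _; rewrite mule_ge0 ?lee_fin.
rewrite integral_cst// muB ge0_integralZl//; last first.
  by move=> x _; rewrite lee_fin.
rewrite EFinD mulrC !EFinM leeD2l// lee_wpmul2l// lee_fin.
Qed.

Lemma exists_point_below Omega N h (s kappa M : R) y r :
  measurable Omega -> ball y r `<=` Omega -> mu (ball y r) = (vol (ball y r))%:E ->
  measurable N -> mu N = 0%E -> measurable_fun Omega h ->
  (forall x, Omega x -> 0 <= h x) -> 0 < r -> 0 < kappa ->
  kappa * r `^ s <= vol (ball y r) ->
  (\int[mu]_(x in Omega) (h x)%:E < (kappa * M)%:E)%E ->
  exists z, [/\ ball y r z, ~ N z & h z <= M / r `^ s].
Proof.
move=> mO BO muB mN N0 mh h0 r0 k0 kV hM.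
have rs0 : 0 < r `^ s by rewrite powR_gt0.
have V0 : 0 < vol (ball y r) by apply: lt_le_trans kV; rewrite mulr_gt0.
have [z [Bz Nz hz]] := exists_small_value mO (measurable_metric_ball y r) BO muB V0 mN N0 mh h0 hM.
exists z; split=> //; rewrite ler_pdivlMr// -(ler_pM2l k0).
apply: le_trans hz; rewrite mulrCA; apply: ler_wpM2l => //.
exact/h0/BO.
Qed.

(** This provides the selection hypothesis of the chaining lemmas, where s / p is 2, 1 or 1/2. It is
    the previous selection applied to the p-th power of [g]. *)
Lemma exists_gradient_below Omega N g (p s kappa K : R) y r :
  measurable Omega -> ball y r `<=` Omega -> mu (ball y r) = (vol (ball y r))%:E ->
  measurable N -> mu N = 0%E -> measurable_fun Omega g ->
  (forall x, Omega x -> 0 <= g x) -> 0 < r -> 0 < kappa -> 0 < p -> 0 < K ->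
  kappa * r `^ s <= vol (ball y r) ->
  (\int[mu]_(x in Omega) (`|g x| `^ p)%:E < (kappa * K `^ p)%:E)%E ->
  exists z, [/\ ball y r z, ~ N z & g z <= K / r `^ (s / p)].
Proof.
move=> mO BO muB mN N0 mg g0 r0 k0 p0 K0 kV gK.
have mh : measurable_fun Omega (fun x => `|g x| `^ p).
  by apply/measurable_EFinP; exact: measurable_powR_norm.
have [z [Bz Nz hz]] := exists_point_below mO BO muB mN N0 mh
  (fun x _ => powR_ge0 _ _) r0 k0 kV gK.
exists z; split=> //; have gz := g0 _ (BO _ Bz).
apply: (powR_le_cancel p0) => //; first by rewrite divr_ge0 ?powR_ge0 ?(ltW K0).
rewrite powR_div ?powR_ge0 ?(ltW K0)// -powRrM divfK ?gt_eqF//.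
by rewrite -{1}(ger0_norm gz).
Qed.

Hypothesis mmX : metric_measure_space mu.
Variables (s kappa : R).
Hypotheses (s0 : 0 < s) (kappa0 : 0 < kappa) (muk : volume_bound mu s kappa).

Lemma volume_boundE x r : 0 < r -> (r%:E <= diam X)%E ->
  kappa * r `^ s <= vol (ball x r).
Proof. by move=> r0 rd; rewrite -lee_fin -mu_ballE//; exact: muk. Qed.

Section on_a_ball.
Variable sigma : R.
Hypothesis sigma1 : 1 < sigma.

(* Balls of radius [margin * R0] around points of [B0] stay in [sigma B0] and
   are not larger than the diameter. *)
Let margin := Num.min (sigma - 1) 1.

Let margin_gt0 : 0 < margin.
Proof. by rewrite lt_min ltr01 andbT subr_gt0. Qed.

Let margin_le1 : margin <= 1.
Proof. by rewrite ge_min lexx orbT. Qed.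

Let margin_ball x0 (R0 : R) x r : 0 < R0 -> ball x0 R0 x -> r <= margin * R0 ->
  ball x r `<=` ball x0 (sigma * R0).
Proof.
move=> R00; rewrite !ballEmdist /= => x0x rm y /= xy.
have := metric_triangle x0 x y.
have : margin * R0 <= (sigma - 1) * R0.
  by rewrite ler_pM2r// /margin ge_min lexx.
lra.
Qed.

Let margin_diam (R0 r : R) : 0 < R0 -> (R0%:E <= diam X)%E -> r <= margin * R0 ->
  (r%:E <= diam X)%E.
Proof.
move=> R00 Rd rm; apply: le_trans Rd; rewrite lee_fin; apply: le_trans rm _.
by rewrite ger_pMl.
Qed.

(** 2 * 40^2 is twice the 100 * 16 of [pointwise_subcritical]; 72 / margin^2 is twice the square of
    the 6 / margin incurred in passing to a common reference point. *)
Let c2 : R := 2 * 40 ^+ 2 + 72 / margin ^+ 2.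
Let c3 : R := (2 * c2) `^ (s / 2).

Definition subcritical_const : R := (c3 * (margin^-1 `^ s + 1)) `^ s^-1.

(** Chosen so that the exponential of 7 n times it is (4^n)^s, the 7 being the cost per scale in
    [pointwise_critical]. *)
Definition critical_exponent : R := s * ln 4 / 7.

Definition critical_const : R :=
  expR (critical_exponent * (2 + 6 / margin)) * 2 `^ s * (1 + 4 `^ s).

Let c2_gt0 : 0 < c2.
Proof.
by apply: addr_gt0; [rewrite mulr_gt0// exprn_gt0|rewrite divr_gt0// exprn_gt0].
Qed.

Let c3_gt0 : 0 < c3.
Proof. by rewrite powR_gt0// mulr_gt0. Qed.

Lemma subcritical_const_gt0 : 0 < subcritical_const.
Proof.
by rewrite powR_gt0// mulr_gt0// addr_gt0// powR_gt0// invr_gt0.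
Qed.

Section gradient.
Variables (x0 : X) (R0 : R) (u g : X -> R) (N : set X) (p K : R).
Let B0 := ball x0 R0.
Let sB0 := ball x0 (sigma * R0).
Let r0 := margin * R0.
Hypotheses (R00 : 0 < R0) (R0d : (R0%:E <= diam X)%E).
Hypotheses (mN : measurable N) (N0 : mu N = 0%E).
Hypotheses (mg : measurable_fun sB0 g) (g0 : forall x, sB0 x -> 0 <= g x).
Hypothesis measurable_u : measurable_fun sB0 u.
Hypothesis ug : forall x y, (sB0 `\` N) x -> (sB0 `\` N) y ->
  `|u x - u y| <= mdist x y * (g x + g y).
Hypotheses (p0 : 0 < p) (K0 : 0 < K).
Hypothesis gK : (\int[mu]_(x in sB0) (`|g x| `^ p)%:E < (kappa * K `^ p)%:E)%E.

Let B0_sB0 : B0 `<=` sB0. Proof. exact: ball_subset_dilate. Qed.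

Let r0_gt0 : 0 < r0. Proof. exact: mulr_gt0. Qed.

Let r0_le : r0 <= R0. Proof. by rewrite /r0 ger_pMl. Qed.

Let select x : B0 x -> forall r, 0 < r -> r <= r0 ->
  exists z, [/\ ball x r z, (sB0 `\` N) z & g z <= K / r `^ (s / p)].
Proof.
move=> Bx r rp rr0; have rB := margin_ball R00 Bx rr0.
have rd := margin_diam R00 R0d rr0.
have [z [rz Nz gz]] := exists_gradient_below (measurable_metric_ball _ _) rB
  (mu_ballE mmX x rp) mN N0 mg g0 rp kappa0 p0 K0 (volume_boundE x rp rd) gK.
by exists z; split=> //; split => //; exact: rB.
Qed.

Lemma select_center :
  exists z, [/\ B0 z, ~ N z & g z <= K / r0 `^ (s / p)].
Proof.
have Bx0 : B0 x0 by rewrite /B0 ballEmdist /= mdistxx.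
have [z [rz [sz Nz] gz]] := select Bx0 r0_gt0 (lexx _).
exists z; split=> //; move: rz; rewrite /B0 !ballEmdist /= => /lt_le_trans; exact.
Qed.

Let Bmeas : mu B0 = (vol B0)%:E. Proof. exact: mu_ballE. Qed.

Let mB0 : measurable B0. Proof. exact: measurable_metric_ball. Qed.

Let measurable_on_B0 (f : X -> R) : measurable_fun sB0 f -> measurable_fun B0 f.
Proof. by apply: measurable_funS => //; exact: measurable_metric_ball. Qed.

Let integral_gradient_B0 :
  (\int[mu]_(x in B0) (`|g x| `^ p)%:E <= (kappa * K `^ p)%:E)%E.
Proof.
apply: le_trans (ltW gK); apply: ge0_subset_integral => //.
- exact: measurable_metric_ball.
- exact: measurable_powR_norm.
Qed.

Let reference_distance x z1 z : B0 x -> ball x r0 z1 -> B0 z ->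
  mdist z1 z <= 3 * R0.
Proof.
rewrite /B0 !ballEmdist /= => xx xz zz.
have := metric_triangle z1 x z; have := metric_triangle x x0 z.
rewrite (metric_sym z1 x) (metric_sym x x0); have := r0_le; lra.
Qed.

Let g_ge0 x : (sB0 `\` N) x -> 0 <= g x. Proof. by move=> [/g0]. Qed.

Let kappaV : kappa * R0 `^ s <= vol B0. Proof. exact: volume_boundE. Qed.

(** Each [x] is joined by a chain to a point [z1] depending on [x], and [z1] directly to the fixed
    [z]. The bound on the squared oscillation, raised to the power p = s/2, is affine in g^p and can
    be integrated. *)
Lemma subcritical_bound z : p = s / 2 -> B0 z -> ~ N z -> g z <= K / r0 ^+ 2 ->
  (\int[mu]_(x in B0) (`|u x - u z| `^ s)%:E <=
   (vol B0 * (subcritical_const * K / R0) `^ s)%:E)%E.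
Proof.
move=> ps Bz Nz gz.
have sp2 : s / p = 2 by rewrite ps; field; rewrite gt_eqF.
have muB : measurable_fun B0 (fun x => u x - u z).
  apply: measurable_funB; last exact: measurable_cst.
  exact: measurable_on_B0 measurable_u.
have mgB : measurable_fun B0 g by exact: measurable_on_B0 mg.
have r0m : r0 = margin * R0 by [].
apply: (@le_trans _ _ (vol B0 * (c3 * (K / r0) `^ s) +
    (c3 * K `^ p) * (kappa * K `^ p))%:E).
  apply: (integral_affine_bound mB0 Bmeas mN N0 (f := fun x => `|g x| `^ p)) => //.
  - by rewrite mulr_ge0 ?powR_ge0 ?(ltW c3_gt0).
  - by rewrite mulr_ge0 ?powR_ge0 ?(ltW c3_gt0).
  - by apply/measurable_EFinP; exact: measurable_powR_norm.
  - by apply/measurable_EFinP; exact: measurable_powR_norm.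
  move=> x Bx Nx; have sx : (sB0 `\` N) x by split=> //; exact: B0_sB0.
  have sel r : 0 < r -> r <= r0 ->
      exists z, [/\ ball x r z, (sB0 `\` N) z & g z <= K / r ^+ 2].
    by move=> rp rr0; have := select Bx rp rr0; rewrite sp2 powR_mulrn// ltW.
  have [z1 [z1r sz1 gz1 hx]] := pointwise_subcritical g_ge0 ug sx r0_gt0 K0 sel.
  have sz : (sB0 `\` N) z by split=> //; exact: B0_sB0.
  have h2 : `|u z1 - u z| <= 6 / margin * (K / r0).
    apply: le_trans (ug sz1 sz) _.
    have -> : 6 / margin * (K / r0) = 3 * R0 * (K / r0 ^+ 2 + K / r0 ^+ 2).
      by rewrite r0m; field; rewrite !gt_eqF.
    apply: ler_pM; rewrite ?mdist_ge0 ?addr_ge0 ?g_ge0 ?lerD//.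
    exact: reference_distance z1r Bz.
  have hsq : `|u x - u z| ^+ 2 <= c2 * ((K / r0) ^+ 2 + K * g x).
    have h3 : `|u x - u z| <= `|u x - u z1| + `|u z1 - u z|.
      by rewrite (_ : u x - u z = (u x - u z1) + (u z1 - u z)) ?ler_normD//; ring.
    have h4 : `|u z1 - u z| ^+ 2 <= 36 / margin ^+ 2 * (K / r0) ^+ 2.
      have -> : 36 / margin ^+ 2 * (K / r0) ^+ 2 = (6 / margin * (K / r0)) ^+ 2.
        by field; rewrite !gt_eqF.
      by rewrite ler_pXn2r ?nnegrE ?(le_trans (normr_ge0 _) h2).
    have h5 : `|u x - u z| ^+ 2 <= 2 * `|u x - u z1| ^+ 2 + 2 * `|u z1 - u z| ^+ 2.
      have := normr_ge0 (u x - u z); have := normr_ge0 (u x - u z1).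
      have := normr_ge0 (u z1 - u z).
      have := sqr_ge0 (`|u x - u z1| - `|u z1 - u z|); nra.
    have m0 : 0 < 72 / margin ^+ 2 by rewrite divr_gt0// exprn_gt0.
    have Kg : 0 <= K * g x by rewrite mulr_ge0 ?(ltW K0)// g_ge0.
    have Kr : 0 <= (K / r0) ^+ 2 by exact: sqr_ge0.
    rewrite /c2 mulrDl !mulrDr.
    have := mulr_ge0 (ltW m0) Kg; lra.
  have -> : `|u x - u z| `^ s = (`|u x - u z| ^+ 2) `^ p.
    by rewrite -powR_mulrn// -powRrM ps; congr (_ `^ _); field.
  apply: le_trans (le_powR (ltW p0) (sqr_ge0 _) hsq) _.
  have Kg : 0 <= K * g x by rewrite mulr_ge0 ?(ltW K0)// g_ge0.
  rewrite powRM ?(ltW c2_gt0) ?addr_ge0 ?sqr_ge0//.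
  apply: le_trans (_ : c2 `^ p * (2 `^ p * (((K / r0) ^+ 2) `^ p + (K * g x) `^ p)) <= _).
    by apply: ler_wpM2l; rewrite ?powR_ge0// powRD_le ?sqr_ge0 ?(ltW p0).
  rewrite (powRM p (ltW K0)) ?g_ge0// -powR_mulrn ?divr_ge0 ?(ltW K0) ?(ltW r0_gt0)//.
  rewrite -[((K / r0) `^ 2%:R) `^ p]powRrM (_ : 2%:R * p = s); last by rewrite ps; field.
  have -> : c3 = 2 `^ p * c2 `^ p by rewrite /c3 -ps powRM ?(ltW c2_gt0).
  rewrite (ger0_norm (g_ge0 sx)) le_eqVlt.
  by apply/orP; left; apply/eqP; ring.
rewrite lee_fin.
have KR0 : 0 <= K / R0 by rewrite divr_ge0 ?(ltW K0) ?(ltW R00).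
have e1 : (K / r0) `^ s = margin^-1 `^ s * (K / R0) `^ s.
  rewrite -powRM ?invr_ge0 ?(ltW margin_gt0)//; congr (_ `^ _).
  by rewrite r0m; field; rewrite !gt_eqF.
have e2 : (subcritical_const * K / R0) `^ s =
    c3 * (margin^-1 `^ s + 1) * (K / R0) `^ s.
  rewrite -mulrA powRM ?(ltW subcritical_const_gt0)// /subcritical_const.
  by rewrite powRVK ?gt_eqF// mulr_ge0 ?addr_ge0 ?powR_ge0 ?(ltW c3_gt0).
(* The volume bound for [B0] itself turns the contribution of g^p into a multiple of the measure of
   [B0]. *)
have e3 : kappa * (K `^ p * K `^ p) <= vol B0 * (K / R0) `^ s.
  rewrite -powRD; last by apply/implyP => _; rewrite gt_eqF.
  have -> : p + p = s by rewrite ps; field.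
  have R0s : 0 < R0 `^ s by rewrite powR_gt0.
  rewrite powR_div ?(ltW K0) ?(ltW R00)//.
  rewrite [leRHS](_ : _ = vol B0 / R0 `^ s * K `^ s); last by ring.
  by apply: ler_wpM2r; rewrite ?powR_ge0// ler_pdivlMr.
rewrite e1 e2.
have := ler_wpM2l (ltW c3_gt0) e3; set W := (K / R0) `^ s; set M := margin^-1 `^ s.
set P := K `^ p; lra.
Qed.

(** Exponentiating a bound linear in [n] produces (4^n)^s, which the stopping scale bounds by (1 + 4
    r0 g(x) / K)^s; this is integrable as p = s. *)
Lemma critical_bound z : p = s -> B0 z -> ~ N z -> g z <= K / r0 ->
  (\int[mu]_(x in B0) (expR (critical_exponent * (`|u x - u z| / K)))%:E <=
   (vol B0 * critical_const)%:E)%E.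
Proof.
move=> ps Bz Nz gz.
have sp1 : s / p = 1 by rewrite ps mulfV// gt_eqF.
have muB : measurable_fun B0 (fun x => u x - u z).
  apply: measurable_funB; last exact: measurable_cst.
  exact: measurable_on_B0 measurable_u.
have mgB : measurable_fun B0 g by exact: measurable_on_B0 mg.
have r0m : r0 = margin * R0 by [].
have ln4 : 0 < ln 4 :> R by rewrite ln_gt0// ltr1n.
have ce0 : 0 < critical_exponent by rewrite divr_gt0// mulr_gt0.
pose e0 := expR (critical_exponent * (2 + 6 / margin)) * 2 `^ s.
have e00 : 0 < e0 by rewrite mulr_gt0 ?expR_gt0// powR_gt0.
have rK : 0 < 4 * r0 / K by rewrite divr_gt0// mulr_gt0.
apply: (@le_trans _ _ (vol B0 * e0 +
    (e0 * (4 * r0 / K) `^ s) * (kappa * K `^ p))%:E).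
  apply: (integral_affine_bound mB0 Bmeas mN N0 (f := fun x => `|g x| `^ p)) => //.
  - exact: ltW.
  - by rewrite mulr_ge0 ?powR_ge0 ?(ltW e00).
  - apply: measurableT_comp; first exact: measurable_expR.
    apply: measurable_funM; first exact: measurable_cst.
    apply: measurable_funM; last exact: measurable_cst.
    exact: measurableT_comp.
  - by apply/measurable_EFinP; exact: measurable_powR_norm.
  move=> x Bx Nx; have sx : (sB0 `\` N) x by split=> //; exact: B0_sB0.
  have sel r : 0 < r -> r <= r0 ->
      exists z, [/\ ball x r z, (sB0 `\` N) z & g z <= K / r].
    by move=> rp rr0; have := select Bx rp rr0; rewrite sp1 powRr1// ltW.
  have [z1 [n [z1r sz1 gz1 hx hn]]] := pointwise_critical g_ge0 ug sx r0_gt0 K0 sel.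
  have sz : (sB0 `\` N) z by split=> //; exact: B0_sB0.
  have h2 : `|u z1 - u z| <= K * (6 / margin).
    apply: le_trans (ug sz1 sz) _.
    have -> : K * (6 / margin) = 3 * R0 * (K / r0 + K / r0).
      by rewrite r0m; field; rewrite !gt_eqF.
    apply: ler_pM; rewrite ?mdist_ge0 ?addr_ge0 ?g_ge0 ?lerD//.
    exact: reference_distance z1r Bz.
  have h3 : `|u x - u z| / K <= 2 + 6 / margin + 7 * n%:R.
    rewrite ler_pdivrMr//.
    have : `|u x - u z| <= `|u x - u z1| + `|u z1 - u z|.
      by rewrite (_ : u x - u z = (u x - u z1) + (u z1 - u z)) ?ler_normD//; ring.
    lra.
  apply: (@le_trans _ _ (expR (critical_exponent * (2 + 6 / margin + 7 * n%:R)))).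
    by rewrite ler_expR ler_pM2l.
  rewrite mulrDr expRD.
  have -> : critical_exponent * (7 * n%:R) = s * ln (4 ^+ n).
    by rewrite lnXn// /critical_exponent -mulr_natr; field.
  have -> : expR (s * ln (4 ^+ n)) = (4 ^+ n) `^ s :> R.
    by rewrite mulrC expRM lnK// posrE exprn_gt0.
  have gx := g_ge0 sx.
  rewrite (ger0_norm gx) ps -[_ * g x `^ s]mulrA -powRM ?(ltW rK)//.
  rewrite -[X in _ <= X + _]mulr1 -mulrDr /e0 -[leRHS]mulrA.
  apply: ler_wpM2l; first exact: expR_ge0.
  have h4 : 4 ^+ n <= 1 + 4 * r0 / K * g x.
    by apply: le_trans hn _; rewrite le_eqVlt; apply/orP; left; apply/eqP; field; rewrite gt_eqF.
  apply: le_trans (le_powR (ltW s0) (exprn_ge0 _ _) h4) _ => //.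
  have rKg := mulr_ge0 (ltW rK) gx.
  by apply: le_trans (powRD_le (ltW s0) ler01 rKg) _; rewrite powR1.
rewrite lee_fin /critical_const -/e0 mulrDr mulr1 [leRHS]mulrDr mulrC lerD2l.
have r0s : kappa * r0 `^ s <= vol B0.
  apply: le_trans kappaV; apply: ler_wpM2l; first exact: ltW.
  by apply: le_powR; rewrite ?(ltW s0) ?(ltW r0_gt0).
have r04 : 0 <= 4 * r0 by apply: mulr_ge0 => //; exact: ltW.
rewrite (powR_div _ r04 (ltW K0)) (powRM s (ler0n _ 4) (ltW r0_gt0)) ps.
have Ks : 0 < K `^ s by rewrite powR_gt0.
have -> : e0 * (4 `^ s * r0 `^ s / K `^ s) * (kappa * K `^ s) =
  (e0 * 4 `^ s) * (kappa * r0 `^ s) by field; rewrite gt_eqF.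
rewrite [leRHS](_ : _ = e0 * 4 `^ s * vol B0); last by ring.
by rewrite ler_pM2l// mulr_gt0 ?powR_gt0.
Qed.

End gradient.
End on_a_ball.
End volume_bound_consequences.

(** * McShane's extension, and (b) and (c) from the volume bound *)

Section consequences.
Context {R : realType} {d : measure_display} {X : borelMetricType d R}.
Variable mu : {measure set X -> \bar R}.
Implicit Types (x y z : X) (r p q K : R) (B N Omega : set X) (u g f h : X -> R).
Local Notation vol := (vol mu).

(** Gives the strict inequality demanded by the selection lemmas; it dictates how [K] is chosen from
    the norm [A] of the gradient. *)
Lemma powR_level (kappa A K p : R) : 0 < p -> 0 < kappa -> 0 <= A ->
  kappa^-1 `^ p^-1 * A < K -> A `^ p < kappa * K `^ p.
Proof.
move=> p0 k0 A0 AK; have kA0 : 0 <= kappa^-1 `^ p^-1 * A by rewrite mulr_ge0 ?powR_ge0.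
have K0 : 0 <= K by apply: le_trans (ltW AK).
have : (kappa^-1 `^ p^-1 * A) `^ p < K `^ p.
  by apply: gt0_ltr_powR; rewrite ?nnegrE.
rewrite powRM ?powR_ge0// powRVK ?gt_eqF ?invr_ge0 ?(ltW k0)//.
by rewrite mulrC ltr_pdivrMr// mulrC.
Qed.

Lemma half_exponent (s : R) : 0 < s -> [/\ 0 < s / 2, s / 2 < s,
  s / (s / 2) = 2 & sobolev_conjugate s (s / 2) = s].
Proof.
move=> s0; split; [lra|lra|by field; rewrite gt_eqF|].
rewrite /sobolev_conjugate (_ : s - s / 2 = s / 2); last by field.
by field; rewrite gt_eqF.
Qed.

Lemma volume_normalize_half (s S r : R) : 0 < s -> 0 < S -> 0 < r ->
  (S / r `^ s) `^ (s / 2)^-1 * S^-1 `^ (s / 2)^-1 = r ^- 2.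
Proof.
move=> s0 S0 r0.
have := @volume_normalize _ S 1 (r `^ s) (s / 2)^-1 S0 ler01 (powR_gt0 _ r0).
rewrite powR1 mulr1 => ->.
rewrite powR_div ?powR_ge0// powR1 div1r -powRrM.
have [_ _ -> _] := half_exponent s0.
by rewrite powR_mulrn// ltW.
Qed.

Lemma sqrtr_subadd (a b : R) : 0 <= a -> 0 <= b ->
  Num.sqrt (a + b) <= Num.sqrt a + Num.sqrt b.
Proof.
move=> a0 b0; rewrite -(@ler_pXn2r _ 2)// ?nnegrE ?addr_ge0 ?sqrtr_ge0//.
rewrite sqr_sqrtr ?addr_ge0// sqrrD !sqr_sqrtr//.
have : 0 <= Num.sqrt a * Num.sqrt b by rewrite mulr_ge0 ?sqrtr_ge0.
lra.
Qed.

(* [sqrt (mdist x y)] is again a metric, so McShane's extension applies. *)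
Lemma mcshane_sqrt N u (L : R) : 0 <= L -> (exists x, ~ N x) ->
  (forall x y, ~ N x -> ~ N y -> `|u x - u y| <= L * Num.sqrt (mdist x y)) ->
  exists v : X -> R, (forall x, ~ N x -> v x = u x) /\
    forall x y, `|v x - v y| <= L * Num.sqrt (mdist x y).
Proof.
move=> L0 [x0 Nx0] uL.
have tri x y z : L * Num.sqrt (mdist x z) <=
    L * Num.sqrt (mdist x y) + L * Num.sqrt (mdist y z).
  rewrite -mulrDr; apply: ler_wpM2l => //.
  apply: le_trans (sqrtr_subadd (mdist_ge0 _ _) (mdist_ge0 _ _)).
  by rewrite ler_sqrt ?addr_ge0 ?mdist_ge0//; exact: metric_triangle.
(* McShane's formula: the extension at [x] is the infimum of [E x]. *)
pose E x := [set u y + L * Num.sqrt (mdist x y) | y in ~` N].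
have E0 x : E x !=set0 by exists (u x0 + L * Num.sqrt (mdist x x0)); exists x0.
have lbE x y : ~ N y -> lbound (E x) (u y - L * Num.sqrt (mdist x y)).
  move=> Ny _ [z Nz <-]; have := uL y z Ny Nz; have := tri y x z.
  rewrite (metric_sym y x) => h1 h2; have := ler_norm (u y - u z); lra.
have hasE x : has_inf (E x).
  by split=> //; exists (u x0 - L * Num.sqrt (mdist x x0)); exact: lbE.
have ltv x y : inf (E x) - inf (E y) <= L * Num.sqrt (mdist x y).
  rewrite lerBlDr addrC -lerBlDr; apply: lb_le_inf => // _ [z Nz <-].
  rewrite lerBlDr; apply: le_trans (_ : u z + L * Num.sqrt (mdist x z) <= _).
    by apply: ge_inf; [exact: (hasE x).2|exists z].
  have := tri x y z; lra.
exists (fun x => inf (E x)); split.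
  move=> x Nx; apply/eqP; rewrite eq_le; apply/andP; split.
    apply: ge_inf; first exact: (hasE x).2.
    by exists x => //; rewrite mdistxx sqrtr0 mulr0 addr0.
  apply: lb_le_inf => //; have := @lbE x x Nx.
  by rewrite mdistxx sqrtr0 mulr0 subr0.
move=> x y; rewrite ler_norml ltv andbT.
have := ltv y x; rewrite (metric_sym y x); lra.
Qed.

Hypothesis mmX : metric_measure_space mu.
Variables (s kappa sigma : R).
Hypotheses (s0 : 0 < s) (kappa0 : 0 < kappa) (muk : volume_bound mu s kappa).
Hypothesis sigma1 : 1 < sigma.

Let mball := @measurable_metric_ball _ _ X.

Lemma poincare_of_volume : exists2 C : R, 0 < C & sobolev_poincare mu sigma s (s / 2) C.
Proof.
have [p0 ps sp2 conj] := half_exponent s0; set p := s / 2 in p0 ps sp2 conj *.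
pose D := subcritical_const s sigma.
have D0 : 0 < D by exact: subcritical_const_gt0.
exists (D * kappa^-1 `^ p^-1).
  by rewrite mulr_gt0// powR_gt0// invr_gt0.
move=> x0 R0 R00 R0d B0 sB0 u g [[mfu _] _] [g0 Lg [N [Nsub mN N0 ug]]].
have [A [A0 _ gA]] := LpP p0 Lg.
have sR0 : 0 < sigma * R0 by rewrite mulr_gt0// (lt_trans ltr01).
have S0 := vol_ball_gt0 mmX x0 sR0.
have V0 := vol_ball_gt0 mmX x0 R00.
pose K0 := kappa^-1 `^ p^-1 * A.
rewrite conj (average_norm_Lp p0 A0 gA) -!EFinM -/(vol sB0).
have -> : D * kappa^-1 `^ p^-1 * (vol sB0 / R0 `^ s) `^ p^-1 *
    (R0 * ((vol sB0)^-1 `^ p^-1 * A)) = D * K0 / R0.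
  rewrite (_ : _ * _ = D * K0 * R0 *
    ((vol sB0 / R0 `^ s) `^ p^-1 * (vol sB0)^-1 `^ p^-1)); last by rewrite /K0; ring.
  by rewrite volume_normalize_half//; field; rewrite gt_eqF.
apply/lee_addgt0Pr => e e0.
(* The excess over [K0] makes the selection strict, even if the gradient vanishes, and contributes
   exactly [e] to the final bound. *)
pose K := K0 + e * R0 / D.
have K00 : 0 <= K0 by rewrite mulr_ge0 ?powR_ge0.
have e'0 : 0 < e * R0 / D by rewrite divr_gt0// mulr_gt0.
have Kp : 0 < K by rewrite ltr_wpDl.
have gK : (\int[mu]_(x in sB0) (`|g x| `^ p)%:E < (kappa * K `^ p)%:E)%E.
  by rewrite gA lte_fin; apply: powR_level => //; rewrite -/K0 ltrDl.
have [z [Bz Nz gz]] := select_center mmX kappa0 muk sigma1 R00 R0d mN N0 Lg.1 g0 p0 Kp gK.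
rewrite sp2 powR_mulrn in gz; last first.
  by apply: ltW; rewrite mulr_gt0// lt_min ltr01 andbT subr_gt0.
have -> : ((D * K0 / R0)%:E + e%:E)%E = (D * K / R0)%:E.
  by rewrite -EFinD; congr EFin; rewrite /K; field; rewrite !gt_eqF.
apply: ge_ereal_inf; exists (average_norm mu B0 s (fun x => u x - u z)); first by exists (u z).
apply: average_norm_le => //; first by apply: ltW; rewrite divr_gt0// mulr_gt0.
exact: (subcritical_bound mmX s0 kappa0 muk sigma1 R00 R0d mN N0 Lg.1 g0 mfu ug p0 Kp gK).
Qed.

(** Here the reference point [z] must make both [g z] and the absolute value of [u z] small;
    selecting for the combined function [h] achieves both at once. *)
Lemma embedding_of_volume : exists2 C : R, 0 < C & sobolev_embedding mu sigma s (s / 2) C.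
Proof.
have [p0 ps sp2 conj] := half_exponent s0; set p := s / 2 in p0 ps sp2 conj *.
pose D := subcritical_const s sigma.
have D0 : 0 < D by exact: subcritical_const_gt0.
pose m := Num.min (sigma - 1) 1.
have m0 : 0 < m by rewrite lt_min ltr01 andbT subr_gt0.
have m1 : m <= 1 by rewrite ge_min lexx orbT.
(* The two summands account for the value at [z] and for the oscillation around it; the 2 comes from
   [powRD_le]. *)
pose D' := 2 * ((m ^- 2) `^ s + D `^ s) `^ s^-1.
have Ds0 : 0 < (m ^- 2) `^ s + D `^ s.
  by rewrite addr_gt0// powR_gt0// invr_gt0 exprn_gt0.
have D'0 : 0 < D' by rewrite mulr_gt0// powR_gt0.
(* The power of 2 compensates for replacing the sum of two p-th powers by 2 Y^p. *)
pose k := (kappa^-1) `^ p^-1 * 2 `^ p^-1.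
have k0 : 0 < k by rewrite mulr_gt0// powR_gt0// invr_gt0.
exists (D' * k); first by rewrite mulr_gt0.
move=> x0 R0 R00 R0d B0 sB0 u g [Lu _] [g0 Lg [N [Nsub mN N0 ug]]].
have mfu := Lu.1.
have [A [A0 _ gA]] := LpP p0 Lg.
have [U [U0 _ uU]] := LpP p0 Lu.
have sR0 : 0 < sigma * R0 by rewrite mulr_gt0// (lt_trans ltr01).
have S0 := vol_ball_gt0 mmX x0 sR0.
have V0 := vol_ball_gt0 mmX x0 R00.
pose Y := R0 * A + U.
have RA0 : 0 <= R0 * A by rewrite mulr_ge0// ltW.
have Y0 : 0 <= Y by rewrite addr_ge0.
rewrite conj (average_norm_Lp p0 A0 gA) (average_norm_Lp p0 U0 uU) -?EFinM -?EFinD -?EFinM -/(vol sB0).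
have -> : D' * k * (vol sB0 / R0 `^ s) `^ p^-1 *
    (R0 * ((vol sB0)^-1 `^ p^-1 * A) + (vol sB0)^-1 `^ p^-1 * U) =
    D' * (k * Y) * R0 ^- 2.
  by rewrite -(@volume_normalize_half s (vol sB0))// /Y; ring.
apply/lee_addgt0Pr => e e0.
pose e' := e * R0 ^+ 2 / D'.
have e'0 : 0 < e' by rewrite divr_gt0// mulr_gt0// exprn_gt0.
pose K := (k * Y + e') / R0.
have Kp : 0 < K by rewrite divr_gt0// ltr_wpDl// mulr_ge0// ltW.
have KR : K * R0 = k * Y + e' by rewrite /K divfK// gt_eqF.
have -> : ((D' * (k * Y) * R0 ^- 2)%:E + e%:E)%E = (D' * K / R0)%:E.
  by rewrite -EFinD; congr EFin; rewrite /K /e'; field; rewrite !gt_eqF.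
pose h x := R0 `^ p * `|g x| `^ p + `|u x| `^ p.
have mgp : measurable_fun sB0 (fun x => (`|g x| `^ p)%:E) by apply: measurable_powR_norm; exact: Lg.1.
have mup : measurable_fun sB0 (fun x => (`|u x| `^ p)%:E) by apply: measurable_powR_norm; exact: Lu.1.
have msB0 : measurable sB0 by exact: mball.
have Ih : (\int[mu]_(x in sB0) (h x)%:E = ((R0 * A) `^ p + U `^ p)%:E)%E.
  rewrite /h; under eq_integral do rewrite EFinD EFinM.
  rewrite ge0_integralD//; first last.
  - exact: measurable_funeM.
  - by move=> x _; rewrite mule_ge0 ?lee_fin ?powR_ge0.
  rewrite ge0_integralZl// ?lee_fin ?powR_ge0//.
  by rewrite gA uU -EFinM -EFinD powRM ?(ltW R00).
have hK : (R0 * A) `^ p + U `^ p < kappa * (K * R0) `^ p.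
  have h1 : (R0 * A) `^ p <= Y `^ p by apply: le_powR; rewrite ?(ltW p0)// lerDl.
  have h2 : U `^ p <= Y `^ p by apply: le_powR; rewrite ?(ltW p0)// lerDr.
  have : (2 `^ p^-1 * Y) `^ p < kappa * (K * R0) `^ p.
    apply: powR_level => //; first by rewrite mulr_ge0 ?powR_ge0.
    by rewrite mulrA KR ltrDl.
  rewrite powRM ?powR_ge0// powRVK ?gt_eqF//; lra.
pose r0 := m * R0.
have r00 : 0 < r0 by exact: mulr_gt0.
have r0R : r0 <= R0 by rewrite /r0 ger_pMl.
have r0d : (r0%:E <= diam X)%E by apply: le_trans R0d; rewrite lee_fin.
have rB : ball x0 r0 `<=` B0.
  by move=> y; rewrite /B0 !ballEmdist /= => /lt_le_trans; apply.
have BsB : B0 `<=` sB0 by exact: ball_subset_dilate.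
have mh : measurable_fun sB0 h.
  apply: measurable_funD; last exact/measurable_EFinP.
  by apply: measurable_funM; [exact: measurable_cst|exact/measurable_EFinP].
have h0 x : sB0 x -> 0 <= h x by move=> _; rewrite addr_ge0 ?mulr_ge0 ?powR_ge0.
have hM : (\int[mu]_(x in sB0) (h x)%:E < (kappa * (K * R0) `^ p)%:E)%E.
  by rewrite Ih lte_fin.
have [z [rz Nz hz]] := exists_point_below msB0 (subset_trans rB BsB)
  (mu_ballE mmX x0 r00) mN N0 mh h0 r00 kappa0 (volume_boundE mmX muk x0 r00 r0d) hM.
have r0s : r0 `^ s = (r0 ^+ 2) `^ p.
  by rewrite -powR_mulrn ?(ltW r00)// -powRrM /p; congr (_ `^ _); field.
have KR0 : 0 <= K * R0 by rewrite mulr_ge0 ?(ltW Kp) ?(ltW R00).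
rewrite r0s -powR_div ?sqr_ge0// in hz.
have M0 : 0 <= K * R0 / r0 ^+ 2 by rewrite divr_ge0 ?sqr_ge0.
have Bz := rB _ rz.
have gz0 := g0 _ (BsB _ Bz).
have gz : g z <= K / r0 ^+ 2.
  rewrite -(ler_pM2l R00).
  apply: (powR_le_cancel p0).
  - by rewrite mulr_ge0// ltW.
  - by rewrite mulr_ge0 ?(ltW R00)// divr_ge0 ?sqr_ge0 ?(ltW Kp).
  rewrite powRM ?(ltW R00)// -[X in _ * X `^ p <= _](ger0_norm gz0).
  rewrite [X in _ <= X `^ p](_ : _ = K * R0 / r0 ^+ 2); last by ring.
  by apply: le_trans hz; rewrite lerDl powR_ge0.
have uz : `|u z| <= K * R0 / r0 ^+ 2.
  apply: (powR_le_cancel p0) => //.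
  by apply: le_trans hz; rewrite lerDr mulr_ge0 ?powR_ge0.
have gK : (\int[mu]_(x in sB0) (`|g x| `^ p)%:E < (kappa * K `^ p)%:E)%E.
  rewrite gA lte_fin; have R0p : 0 < R0 `^ p by rewrite powR_gt0.
  rewrite -(ltr_pM2l R0p) -powRM ?(ltW R00)//.
  have -> : R0 `^ p * (kappa * K `^ p) = kappa * (K * R0) `^ p.
    by rewrite powRM ?(ltW R00) ?(ltW Kp)//; ring.
  by apply: le_lt_trans hK; rewrite lerDl powR_ge0.
have := subcritical_bound mmX s0 kappa0 muk sigma1 R00 R0d mN N0 Lg.1 g0 mfu ug p0 Kp gK erefl Bz Nz gz.
rewrite -/D -/B0 => osc.
have muB : measurable_fun B0 u by apply: measurable_funS mfu.
apply: average_norm_le => //; first by apply: ltW; rewrite divr_gt0// mulr_gt0.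
apply: le_trans (_ : _ <= (vol B0 * (2 `^ s * `|u z| `^ s) +
  2 `^ s * (vol B0 * (D * K / R0) `^ s))%:E)%E _.
  apply: (integral_affine_bound (mball _ _) (mu_ballE mmX x0 R00) mN N0 _ _ _ _ _ _ osc) => //.
  - by apply/measurable_EFinP; exact: measurable_powR_norm.
  - apply/measurable_EFinP; apply: measurable_powR_norm.
    by apply: measurable_funB => //; exact: measurable_cst.
  move=> x Bx Nx /=.
  rewrite -mulrDr; apply: le_trans (powRD_le (ltW s0) (normr_ge0 _) (normr_ge0 _)).
  apply: le_powR; rewrite ?(ltW s0)//.
  by apply: le_trans (ler_normD _ _); rewrite (addrC (u z)) subrK.
rewrite lee_fin.
have KR0' : 0 <= K / R0 by rewrite divr_ge0 ?(ltW Kp) ?(ltW R00).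
have m20 : 0 <= m ^- 2 by rewrite invr_ge0 sqr_ge0.
have e1 : `|u z| `^ s <= (m ^- 2) `^ s * (K / R0) `^ s.
  rewrite -powRM//; apply: le_powR; rewrite ?(ltW s0)//; apply: (le_trans uz).
  by rewrite le_eqVlt; apply/orP; left; apply/eqP; rewrite /r0; field; rewrite !gt_eqF.
have e2 : (D * K / R0) `^ s = D `^ s * (K / R0) `^ s.
  by rewrite -mulrA powRM ?(ltW D0).
have e3 : (D' * K / R0) `^ s = 2 `^ s * ((m ^- 2) `^ s + D `^ s) * (K / R0) `^ s.
  by rewrite -mulrA powRM ?(ltW D'0)// /D' powRM ?powR_ge0// powRVK ?gt_eqF// ltW.
rewrite e2 e3.
have c0 : 0 <= vol B0 * 2 `^ s by rewrite mulr_ge0 ?powR_ge0 ?(ltW V0).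
have := ler_wpM2l c0 e1; set W := (K / R0) `^ s; set M := (m ^- 2) `^ s; set T := 2 `^ s.
lra.
Qed.

End consequences.

(** * Statements (d) and (e) from the volume bound *)

Section critical_and_supercritical.
Context {R : realType} {d : measure_display} {X : borelMetricType d R}.
Variable mu : {measure set X -> \bar R}.
Implicit Types (x y z : X) (r p q K : R) (B N Omega : set X) (u g f h : X -> R).
Local Notation vol := (vol mu).

Hypothesis mmX : metric_measure_space mu.
Variables (s kappa sigma : R).
Hypotheses (s0 : 0 < s) (kappa0 : 0 < kappa) (muk : volume_bound mu s kappa).

Let mball := @measurable_metric_ball _ _ X.

Lemma trudinger_of_volume : 1 < sigma -> exists C1 C2 : R,
  [/\ 0 < C1, 0 < C2 & trudinger mu sigma s C1 C2 1].
Proof.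
move=> sigma1.
pose eta := critical_exponent s; pose E := critical_const s sigma.
have eta0 : 0 < eta by rewrite divr_gt0// mulr_gt0// ln_gt0// ltr1n.
have E0 : 0 < E.
  by rewrite !mulr_gt0 ?expR_gt0 ?powR_gt0// addr_gt0// powR_gt0.
(* As the norm of [g] is positive in (d), the factor 2 alone makes the selection strict. *)
pose k : R := 2 * kappa^-1 `^ s^-1.
have k0 : 0 < k by rewrite mulr_gt0// powR_gt0// invr_gt0.
(* Passing from [u z] to the average of [u] costs the factor [expR E], because they differ by at
   most K E / eta. *)
exists (eta / k), (expR E * E); split.
- by rewrite divr_gt0.
- by rewrite mulr_gt0 ?expR_gt0.
move=> x0 R0 R00 R0d B0 sB0 u g [[mfu _] _] [[g0 Lg [N [Nsub mN N0 ug]]]].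
have [A [A0 -> gA]] := LpP s0 Lg; rewrite lte_fin => Ap.
have V0 := vol_ball_gt0 mmX x0 R00.
have sR0 : 0 < sigma * R0 by rewrite mulr_gt0// (lt_trans ltr01).
have S0 := vol_ball_gt0 mmX x0 sR0.
pose K := k * A.
have Kp : 0 < K by exact: mulr_gt0.
have gK : (\int[mu]_(x in sB0) (`|g x| `^ s)%:E < (kappa * K `^ s)%:E)%E.
  rewrite gA lte_fin; apply: powR_level => //.
  rewrite /K /k; have : 0 < kappa^-1 `^ s^-1 * A.
    by rewrite mulr_gt0// powR_gt0// invr_gt0.
  lra.
have [z [Bz Nz gz]] := select_center mmX kappa0 muk sigma1 R00 R0d mN N0 Lg.1 g0 s0 Kp gK.
have m0 : 0 < Num.min (sigma - 1) 1 by rewrite lt_min ltr01 andbT subr_gt0.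
rewrite mulfV ?gt_eqF// powRr1 in gz; last by apply: ltW; rewrite mulr_gt0.
have := critical_bound mmX s0 kappa0 muk sigma1 R00 R0d mN N0 Lg.1 g0 mfu ug s0 Kp gK erefl Bz Nz gz.
rewrite -/eta -/E -/B0 => bd.
have mB0 : measurable B0 by exact: mball.
have muB : mu B0 = (vol B0)%:E by exact: mu_ballE.
have mfB : measurable_fun B0 u.
  by apply: measurable_funS mfu; [exact: mball|exact: ball_subset_dilate].
have mabs (c : R) : measurable_fun B0 (fun x => `|u x - c|).
  apply: measurableT_comp => //.
  by apply: measurable_funB => //; exact: measurable_cst.
have mexp (a c : R) : measurable_fun B0 (fun x => expR (a * (`|u x - c| / K))).
  apply: measurableT_comp; first exact: measurable_expR.
  apply: measurable_funM; first exact: measurable_cst.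
  by apply: measurable_funM => //; exact: measurable_cst.
have Ke0 : 0 < K / eta by exact: divr_gt0.
(* From t <= exp t the exponential bound also yields the integrability of [u] and the distance of
   its average to [u z]. *)
have abs_exp x : `|u x - u z| <= K / eta * expR (eta * (`|u x - u z| / K)).
  set t := eta * _; have -> : `|u x - u z| = K / eta * t.
    by rewrite /t; field; rewrite !gt_eqF.
  rewrite ler_pM2l//; apply: le_trans (expR_ge1Dx t); by rewrite lerDr.
have osc : (\int[mu]_(x in B0) `|u x - u z|%:E <=
    (vol B0 * 0 + K / eta * (vol B0 * E))%:E)%E.
  apply: (integral_affine_bound mB0 muB mN N0 _ _ _ _ _ _ bd) => //.
  - exact: ltW.
  - by move=> x Bx _; rewrite add0r.
rewrite mulr0 add0r in osc.
have iuz : mu.-integrable B0 (fun x => (u x - u z)%:E).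
  apply/integrableP; split.
    by apply/measurable_EFinP; apply: measurable_funB => //; exact: measurable_cst.
  under eq_integral do rewrite abse_EFin.
  by apply: le_lt_trans osc (ltry _).
have icst : mu.-integrable B0 (cst (u z)%:E).
  apply/integrableP; split; first exact: measurable_cst.
  rewrite (_ : (fun x => `|cst (u z)%:E x|)%E = cst (`|u z|%:E)); last by apply/funext.
  by rewrite integral_cst// muB -EFinM ltry.
have iu : mu.-integrable B0 (EFin \o u).
  have -> : EFin \o u = (fun x => (u x - u z)%:E + cst (u z)%:E x)%E.
    by apply/funext => x /=; rewrite -EFinD subrK.
  exact: integrableD.
split => //=.
set uB := fine _.
have uBz : `|uB - u z| <= K / eta * E.
  have : (`|\int[mu]_(x in B0) (u x - u z)%:E| <= (K / eta * (vol B0 * E))%:E)%E.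
    apply: le_trans osc; apply: le_trans (le_abse_integral mu mB0 _) _ => //.
    by case/integrableP : iuz.
  under eq_integral do rewrite EFinB.
  rewrite integralB// integral_cst// muB.
  have : (\int[mu]_(x in B0) (u x)%:E)%E \is a fin_num by exact: integrable_fin_num.
  rewrite /uB /average -/(vol B0) /=.
  case: (integral _ _ _) => //= I _.
  rewrite lee_fin.
  have -> : I - u z * vol B0 = vol B0 * ((vol B0)^-1 * I - u z).
    by field; rewrite gt_eqF.
  by rewrite normrM (gtr0_norm V0) mulrCA ler_pM2l.
have bd2 : (\int[mu]_(x in B0) (expR (eta * (`|u x - uB| / K)))%:E <=
    (vol B0 * 0 + expR E * (vol B0 * E))%:E)%E.
  apply: (integral_affine_bound mB0 muB mN N0 _ _ _ _ _ _ bd) => //.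
  move=> x Bx _; rewrite add0r -expRD ler_expR.
  have -> : E + eta * (`|u x - u z| / K) = eta / K * (K / eta * E + `|u x - u z|).
    by field; rewrite !gt_eqF.
  rewrite mulrA mulrAC; apply: ler_wpM2l; first by rewrite divr_ge0 ?(ltW eta0) ?(ltW Kp).
  have : `|u x - uB| <= `|u x - u z| + `|u z - uB|.
    by rewrite (_ : u x - uB = (u x - u z) + (u z - uB)) ?ler_normD//; ring.
  by rewrite (distrC (u z)); lra.
rewrite /average -/(vol B0).
rewrite (eq_integral (fun x => (expR (eta * (`|u x - uB| / K)))%:E)); last first.
  move=> x _; congr EFin; congr expR.
  have e : eta / k * (`|u x - uB| / A) = eta * (`|u x - uB| / K).
    by rewrite /K; field; rewrite !gt_eqF.
  rewrite e powRr1//; apply: (mulr_ge0 (ltW eta0)); exact: divr_ge0 (ltW Kp).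
apply: le_trans (lee_wpmul2l _ bd2) _; first by rewrite lee_fin invr_ge0 ltW.
rewrite -EFinM lee_fin mulr0 add0r le_eqVlt; apply/orP; left; apply/eqP.
by field; rewrite gt_eqF.
Qed.

Lemma morrey_of_volume : exists2 C : R, 0 < C & morrey mu s (2 * s) C.
Proof.
pose p := 2 * s.
have p0 : 0 < p by exact: mulr_gt0.
have sp : s / p = 2^-1 by rewrite /p; field; rewrite gt_eqF.
have sp' : 1 - s / p = 2^-1 by rewrite sp; field.
pose k := kappa^-1 `^ p^-1.
have k0 : 0 < k by rewrite powR_gt0// invr_gt0.
(* 22 = 8 + 8 + 6: one chain from each of the two points, and the step between the ends of the
   chains. *)
exists (22 * k); first by rewrite mulr_gt0.
move=> u [[mfu Lu] [g1 Dg1]].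
have main g : hajlasz_gradients mu [set: X] p u g ->
    exists v : X -> R, {ae mu, forall x, v x = u x} /\
      forall x y : X, `|v x - v y| <=
        22 * k * mdist x y `^ (1 - s / p) * fine (Lp_norm mu [set: X] p g).
  move=> [g0 Lg [N [_ mN N0 ug]]].
  have [A [A0 -> gA]] := LpP p0 Lg; rewrite sp' /=.
  have g_ge0 x : ([set: X] `\` N) x -> 0 <= g x by move=> _; exact: g0.
  have kA0 : 0 <= k * A by rewrite mulr_ge0// ltW.
  have holder x y : ~ N x -> ~ N y ->
      `|u x - u y| <= 22 * k * A * Num.sqrt (mdist x y).
    move=> Nx Ny; have [->|xy] := eqVneq x y.
      by rewrite subrr normr0 mulr_ge0 ?sqrtr_ge0// -mulrA mulr_ge0.
    have r0 : 0 < mdist x y by rewrite mdist_gt0.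
    set r := mdist x y in r0 *.
    have sr0 : 0 < Num.sqrt r by rewrite sqrtr_gt0.
    apply/ler_addgt0Pr => e e0.
    pose K := k * A + e / (22 * Num.sqrt r).
    have e'0 : 0 < e / (22 * Num.sqrt r) by rewrite divr_gt0// mulr_gt0.
    have Kp : 0 < K by rewrite ltr_wpDl.
    have gK : (\int[mu]_(x in [set: X]) (`|g x| `^ p)%:E < (kappa * K `^ p)%:E)%E.
      by rewrite gA lte_fin; apply: powR_level => //; rewrite ltrDl.
    have sel w t : 0 < t -> t <= r -> exists z,
        [/\ ball w t z, ([set: X] `\` N) z & g z <= K / Num.sqrt t].
      (* Radii up to the distance of two points are admissible in the volume bound. *)
      move=> t0 tr; have td : (t%:E <= diam X)%E.
        by apply: le_trans (mdist_le_diam x y); rewrite lee_fin.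
      have [z [wz Nz gz]] := exists_gradient_below measurableT (@subsetT _ (ball w t))
        (mu_ballE mmX w t0) mN N0 Lg.1 g0 t0 kappa0 p0 Kp
        (volume_boundE mmX muk w t0 td) gK.
      by exists z; split=> //; rewrite sp powR12_sqrt// ltW in gz.
    have [x1 [xx1 Gx1 gx1 hx1]] := pointwise_supercritical g_ge0 ug (conj I Nx) r0 Kp (sel x).
    have [y1 [yy1 Gy1 gy1 hy1]] := pointwise_supercritical g_ge0 ug (conj I Ny) r0 Kp (sel y).
    have d1 : mdist x1 y1 <= 3 * r.
      move: xx1 yy1; rewrite !ballEmdist /= => xx1 yy1.
      have := metric_triangle x1 x y1; have := metric_triangle x y y1.
      rewrite (metric_sym x1 x) -/r; lra.
    have h1 : `|u x1 - u y1| <= 6 * K * Num.sqrt r.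
      apply: le_trans (ug _ _ Gx1 Gy1) _.
      have -> : 6 * K * Num.sqrt r = 3 * r * (K / Num.sqrt r + K / Num.sqrt r).
        have er : r = Num.sqrt r ^+ 2 by rewrite sqr_sqrtr// ltW.
        by rewrite [X in 3 * X]er; field; rewrite gt_eqF.
      by apply: ler_pM; rewrite ?mdist_ge0 ?addr_ge0 ?g_ge0 ?lerD.
    have -> : 22 * k * A * Num.sqrt r + e = 22 * K * Num.sqrt r.
      by rewrite /K; field; rewrite gt_eqF.
    have -> : u x - u y = (u x - u x1) + (u x1 - u y1) - (u y - u y1) by ring.
    have t1 := ler_normB (u x - u x1 + (u x1 - u y1)) (u y - u y1).
    have t2 := ler_normD (u x - u x1) (u x1 - u y1).
    by lra.
  have [x1 _] := mmX.1.
  have NN : exists x, ~ N x.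
    have [z _ Nz] := @ae_exists_in_ball _ _ _ mu mmX (fun x => ~ N x) x1 1
      (ae_off_null mN N0 (fun x => id)) ltr01.
    by exists z.
  have L0 : 0 <= 22 * k * A by rewrite -mulrA mulr_ge0.
  have [v [vu hv]] := mcshane_sqrt L0 NN holder.
  exists v; split; first exact: (ae_off_null mN N0).
  move=> x y; rewrite powR12_sqrt ?mdist_ge0// mulrAC; exact: hv.
split=> //; have [v [vu hv]] := main _ Dg1.
exists v; split=> //; exists (22 * k * fine (Lp_norm mu [set: X] p g1)) => x y.
by apply: le_trans (hv x y) _; rewrite mulrAC.
Qed.

End critical_and_supercritical.
Theorem theorem1 (R : realType) (d : measure_display) (X : borelMetricType d R)
    (mu : {measure set X -> \bar R}) (sigma s : R)
    (mmX : metric_measure_space mu) (upX : uniformly_perfect X)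
    (sigma1 : 1 < sigma) (s0 : 0 < s) :
  [<->
   (* (a) *)
   exists kappa : R, 0 < kappa /\
     forall (x : X) (r : R), 0 < r -> (r%:E <= diam X)%E ->
       ((kappa * r `^ s)%:E <= mu (ball x r))%E;
   (* (b) *)
   exists p C : R, [/\ 0 < p, p < s, 0 < C &
     forall (x0 : X) (R0 : R), 0 < R0 -> (R0%:E <= diam X)%E ->
     let B0 := ball x0 R0 in
     let sB0 := ball x0 (sigma * R0) in
     forall u g : X -> R, hajlasz_sobolev mu sB0 p u ->
       hajlasz_gradients mu sB0 p u g ->
       (average_norm mu B0 (sobolev_conjugate s p) u <=
        (C * (fine (mu sB0) / R0 `^ s) `^ p^-1)%:E *
        (R0%:E * average_norm mu sB0 p g + average_norm mu sB0 p u))%E];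
   (* (c) *)
   exists p C : R, [/\ 0 < p, p < s, 0 < C &
     forall (x0 : X) (R0 : R), 0 < R0 -> (R0%:E <= diam X)%E ->
     let B0 := ball x0 R0 in
     let sB0 := ball x0 (sigma * R0) in
     forall u g : X -> R, hajlasz_sobolev mu sB0 p u ->
       hajlasz_gradients mu sB0 p u g ->
       (ereal_inf [set average_norm mu B0 (sobolev_conjugate s p)
                         (fun x => (u x - gamma)%R) | gamma in [set: R]] <=
        (C * (fine (mu sB0) / R0 `^ s) `^ p^-1)%:E *
        (R0%:E * average_norm mu sB0 p g))%E];
   (* (d) *)
   exists C1 C2 gamma : R, [/\ 0 < C1, 0 < C2, 0 < gamma &
     forall (x0 : X) (R0 : R), 0 < R0 -> (R0%:E <= diam X)%E ->
     let B0 := ball x0 R0 in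
     let sB0 := ball x0 (sigma * R0) in
     forall u g : X -> R, hajlasz_sobolev mu sB0 s u ->
       hajlasz_gradients_pos mu sB0 s u g ->
       mu.-integrable B0 (EFin \o u) /\
       let uB0 := fine (average mu B0 (EFin \o u)) in
       (average mu B0 (fun x =>
          (expR ((C1 * (`|u x - uB0| / fine (Lp_norm mu sB0 s g))) `^ gamma))%:E)
        <= C2%:E)%E];
   (* (e) *)
   exists p C : R, [/\ s < p, 0 < C &
     forall u : X -> R, hajlasz_sobolev mu [set: X] p u ->
       (forall g : X -> R, hajlasz_gradients mu [set: X] p u g ->
          exists v : X -> R, {ae mu, forall x, v x = u x} /\
            forall x y : X, `|v x - v y| <=
              C * mdist x y `^ (1 - s / p) * fine (Lp_norm mu [set: X] p g)) /\
       (exists v : X -> R, {ae mu, forall x, v x = u x} /\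
          exists K : R, forall x y : X,
            `|v x - v y| <= K * mdist x y `^ (1 - s / p))]].

Proof.
have of_estimate tau q D : 1 < tau -> 0 < q -> 0 < D ->
    cutoff_estimate mu s tau q D -> exists kappa, 0 < kappa /\ volume_bound mu s kappa.
  by move=> tau1 q0 D0; exact: cutoff_estimate_volume.
(* Each of (b), (c), (d) is first led back to (a), and the next statement is then derived from (a);
   the exponents thus need not be related from one statement to the next. *)
tfae.
- move=> [kappa [k0 muk]]; have [C C0 h] := embedding_of_volume mmX s0 k0 muk sigma1.
  by have [p0 ps _ _] := half_exponent s0; exists (s / 2), C; split.
- move=> [p [C [p0 ps C0 h]]].
  have [D D0 W] := embedding_cutoff_estimate mmX sigma1 p0 ps C0 h.
  have [kappa [k0 muk]] := of_estimate _ _ _ (conjugate_div p0 ps) (conjugate_gt0 p0 ps) D0 W.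
  have [C' C'0 h'] := poincare_of_volume mmX s0 k0 muk sigma1.
  by have [p'0 p's _ _] := half_exponent s0; exists (s / 2), C'; split.
- move=> [p [C [p0 ps C0 h]]].
  have [D D0 W] := poincare_cutoff_estimate mmX sigma1 p0 ps C0 h.
  have [kappa [k0 muk]] := of_estimate _ _ _ (conjugate_div p0 ps) (conjugate_gt0 p0 ps) D0 W.
  have [C1 [C2 [C10 C20 h']]] := trudinger_of_volume mmX s0 k0 muk sigma1.
  by exists C1, C2, 1; split.
- move=> [C1 [C2 [gamma [C10 C20 gamma0 h]]]].
  have [tau [q [D [tau1 q0 D0 W]]]] := trudinger_cutoff_estimate mmX sigma1 s0 C10 C20 gamma0 h.
  have [kappa [k0 muk]] := of_estimate _ _ _ tau1 q0 D0 W.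
  have [C C0 h'] := morrey_of_volume mmX s0 k0 muk.
  by exists (2 * s), C; split=> //; lra.
- move=> [p [C [sp C0 h]]]; exact: (morrey_volume mmX upX s0 sp C0 h).
Qed.
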